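(* Let $\psi$ be an indecomposable linear representation of the poset with involution $P=\mathbf 2+\mathbf 2+\mathbf 2$ in a vector space $V$ over $\mathbf k$. The following are equivalent: 1. There is a symplectic representation $\varphi$ of $P$ (for some symplectic form on $V$) whose underlying linear representation is $\hat\varphi=\psi$. 2. $\psi$ is self-dual and $\dim V$ is even.
   Context: Standing assumptions: $\mathbf k$ is a perfect field with $\operatorname{char}\mathbf k\neq 2$; all vector spaces are finite-dimensional over $\mathbf k$. The poset $P=\mathbf 2+\mathbf 2+\mathbf 2$ has six elements $i_1,c_1,i_2,c_2,i_3,c_3$, the only non-trivial relations being $i_j\le c_j$ $(j=1,2,3)$; it carries the order-reversing involution $\perp$ exchanging $i_j$ and $c_j$. A linear representation of $P$ in $V$ is an order-preserving map $\psi$ from $P$ to the poset $\Sigma(V)$ of subspaces of $V$, i.e. subspaces $I_j=\psi(i_j)\subseteq C_j=\psi(c_j)\subseteq V$. An isomorphism between representations $\psi$ in $V$ and $\psi'$ in $V'$ is a linear bijection $f:V\to V'$ with $f(\psi(p))=\psi'(p)$ for all $p\in P$. A representation is indecomposable if $V\ne0$ and there is no decomposition $V=U'\oplus U''$ with $U',U''\neq 0$ and $\psi(p)=(\psi(p)\cap U')\oplus(\psi(p)\cap U'')$ for all $p$. The dual of $\psi$ is the representation $\psi^*$ in $V^*$ given by $\psi^*(p)=\psi(p^\perp)^\circ$, where $A^\circ\subseteq V^*$ denotes the annihilator of $A\subseteq V$; $\psi$ is self-dual if $\psi\cong\psi^*$. A symplectic representation of $P$ in a symplectic space $(V,\omega)$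 is an order-preserving map $\varphi:P\to\Sigma(V)$ with $\varphi(p^\perp)=\varphi(p)^\perp$ for all $p$ (the right-hand $\perp$ being the $\omega$-orthogonal); $\hat\varphi$ denotes $\varphi$ regarded just as a linear representation. *)

(* Defs.v *)
From HB Require Import structures.
From mathcomp Require Import all_boot all_order all_algebra all_field.

Set Implicit Arguments.
Unset Strict Implicit.
Unset Printing Implicit Defensive.

Import Order.TTheory GRing.Theory.
Local Open Scope ring_scope.

Definition perfect_field (k : fieldType) : Prop :=
  forall p : {poly k}, irreducible_poly p -> separable_poly p.

(* The poset 2 + 2 + 2: (j, false) encodes i_j and (j, true) encodes c_j.
   The alias carries the order of the disjoint sum of three copies of the
   two-element chain [bool]. *)
Definition P222 : Type := ('I_3 * bool)%type.
HB.instance Definition _ := Finite.on P222.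

Definition P222_le (p q : P222) : bool := (p.1 == q.1) && (p.2 <= q.2)%O.

Fact P222_le_refl : reflexive P222_le.
Proof. by move=> p; rewrite /P222_le eqxx lexx. Qed.

Fact P222_le_anti : antisymmetric P222_le.
Proof.
move=> [i a] [j b] /andP[/andP[/= /eqP-> ab] /andP[_ ba]].
by congr (_, _); apply/le_anti/andP.
Qed.

Fact P222_le_trans : transitive P222_le.
Proof.
move=> q p r /andP[/eqP pq1 pq2] /andP[/eqP qr1 qr2].
by rewrite /P222_le pq1 qr1 eqxx (le_trans pq2 qr2).
Qed.

Fact P222_display : Order.disp_t. Proof. exact: Order.Disp tt tt. Qed.
HB.instance Definition _ := Order.Le_isPOrder.Build P222_display P222
  P222_le_refl P222_le_anti P222_le_trans.

Lemma P222_leE (p q : P222) : (p <= q)%O = (p.1 == q.1) && (p.2 ==> q.2).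
Proof. by case: p q => [i []] [j []]. Qed.

Definition P222_perp (p : P222) : P222 := (p.1, ~~ p.2).

Lemma P222_perpK : involutive P222_perp.
Proof. by case=> j b; rewrite /P222_perp /= negbK. Qed.

Lemma P222_le_perp (p q : P222) : (P222_perp p <= P222_perp q)%O = (q <= p)%O.
Proof.
by rewrite !P222_leE /= eq_sym; case: p.2; case: q.2.
Qed.

Record linrep (k : fieldType) (V : vectType k) := LinRep {
  linrep_fun :> P222 -> {vspace V};
  linrep_homo : {homo linrep_fun : p q / (p <= q)%O >-> (p <= q)%VS}
}.

Definition linrep_iso (k : fieldType) (V W : vectType k)
    (psi : linrep V) (psi' : linrep W) : Prop :=
  exists2 f : 'Hom(V, W), bijective f & forall p, (f @: psi p)%VS = psi' p.

Definition indecomposable (k : fieldType) (V : vectType k) (psi : linrep V) : Prop :=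
  (fullv : {vspace V}) != 0%VS /\
  ~ exists U1 U2 : {vspace V},
      [/\ U1 != 0%VS, U2 != 0%VS, (U1 + U2)%VS = fullv, directv (U1 + U2) &
          forall p, (psi p :&: U1 + psi p :&: U2)%VS = psi p /\
                    directv ((psi p :&: U1) + (psi p :&: U2))].

Section Annihilator.
Variables (k : fieldType) (V : vectType k).

(* As {vspace _} has no comprehension, A° is cut out by the evaluations at a
   basis of A; mem_annihilator is the usual description. *)
Definition annihilator (A : {vspace V}) : {vspace 'Hom(V, k^o)} :=
  (\bigcap_(i < \dim A)
     lker (linfun (fun f : 'Hom(V, k^o) => f (vbasis A)`_i : k^o)))%VS.

Let eval_linear (v : V) : linear (fun f : 'Hom(V, k^o) => f v : k^o).
Proof. by move=> a f g; rewrite !lfunE /= !lfunE. Qed.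

Lemma mem_annihilator (A : {vspace V}) (f : 'Hom(V, k^o)) :
  reflect {in A, forall v, f v = 0} (f \in annihilator A).
Proof.
have evE v (g : 'Hom(V, k^o)) :
  linfun (fun f : 'Hom(V, k^o) => f v : k^o) g = g v.
  pose L := GRing.isLinear.Build _ _ _ _ _ (eval_linear v).
  pose e : {linear 'Hom(V, k^o) -> k^o} := HB.pack (fun f : 'Hom(V, k^o) => f v : k^o) L.
  exact: (lfunE e).
apply: (iffP subv_bigcapP) => [fA v /coord_vbasis-> | fA i _].
  rewrite linear_sum big1 // => i _; rewrite linearZ /=.
  have := fA i isT; rewrite -memvE memv_ker evE => /eqP->.
  by rewrite scaler0.
rewrite -memvE memv_ker evE; apply/eqP/fA.
by rewrite vbasis_mem ?mem_nth ?size_tuple.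
Qed.

Lemma annihilatorS (A B : {vspace V}) :
  (A <= B)%VS -> (annihilator B <= annihilator A)%VS.
Proof.
move=> /subvP sAB; apply/subvP => f /mem_annihilator fB.
by apply/mem_annihilator => v /sAB /fB.
Qed.

End Annihilator.

Section Dual.
Variables (k : fieldType) (V : vectType k) (psi : linrep V).

Definition dual_fun (p : P222) : {vspace 'Hom(V, k^o)} :=
  annihilator (psi (P222_perp p)).

Fact dual_homo : {homo dual_fun : p q / (p <= q)%O >-> (p <= q)%VS}.
Proof.
by move=> p q pq; apply/annihilatorS/linrep_homo; rewrite P222_le_perp.
Qed.

Definition dual_rep : linrep 'Hom(V, k^o) := LinRep dual_homo.

Definition self_dual : Prop := linrep_iso psi dual_rep.

End Dual.

Record symprep (k : fieldType) (V : vectType k) (omega : {skew_symmetric V}) :=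
  SympRep {
    symprep_linrep : linrep V;
    symprep_perp : forall p,
      symprep_linrep (P222_perp p) = orthov omega (symprep_linrep p)
  }.

(* Main.v *)
From HB Require Import structures.
Require Import Defs.
From mathcomp Require Import all_boot all_order all_algebra all_field.

Set Implicit Arguments.
Unset Strict Implicit.
Unset Printing Implicit Defensive.

Import GRing.Theory.
Import passmx.
Local Open Scope ring_scope.

(** Write I_j = psi (j, false) and C_j = psi (j, true), and let E be the
algebra of endomorphisms of V preserving all the psi p. A symplectic form
compatible with psi identifies psi with its dual and forces dim V to be even,
so the content is the converse.

A self-duality is a nondegenerate form B with psi (p^perp) the orthogonal of
psi p, and its transpose has the same property, so B y x = B (a x) y with a in
E. By Fitting's lemma [fitting] an element of E is nilpotent or injective, and
1 - a, 1 + a are not both nilpotent since their sum is 2. If 1 - a is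
injective, B - B^T is the wanted symplectic form. Otherwise b = B + B^T is a
nondegenerate symmetric form with the same orthogonality property, and it
remains to find an injective g in E which is skew for b, for then b (g x) y is
symplectic: this is [skew_element], where the parity of dim V enters.

The three isotropic subspaces I_j are brought into a normal form. First, I_i
and C_j meet in 0 for i <> j. Indeed the elements of I_i that can be continued
through a chain, x_i - x_(i-1) in C_(i+1), x_(i-1) - x_(i-2) in C_i and so on
down to 0 (indices modulo 3), span a subspace L which is totally isotropic,
hence not V, and L is a direct summand; so L = 0. That L splits off is the
point: the conditions on a projection onto L are linear, and by duality for
the trace form the obstruction to solving them vanishes
([retraction_criterion]). Counting dimensions, V is the direct sum of I_i and
C_j whenever i <> j [addv_IC].

Hence I_1 and I_2, the latter written with index -1, are identified with X =
I_0, and in these coordinates the restriction of b to U = I_0 + I_1 + I_2 is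
determined by one nondegenerate, not necessarily symmetric, form c on X
([gram01], [gram02], [gram12]). Let u be its cosquare, c (u x) y = - c y x.
When dim V is even the orthogonal of U lies in U (otherwise a rank one element
of E fixes a vector), and counting dimensions gives dim V = dim X + dim ker (u
- 1) modulo 2, while c - c^T is a skew form on X with kernel ker (u + 1), so
dim X = dim ker (u + 1) modulo 2. An endomorphism of X commuting with u
extends to V, provided that it and its adjoint respect the kernel K of the sum
of the three coordinate maps [transport]. Therefore X inherits
indecomposability: if u - 1 has a kernel, then it is nilpotent and the kernel
is a line, and if it has none the same holds for u + 1 [core_block]. With the
two parity relations this excludes both kernels when dim V is even. Then u -
u^-1 is injective and skew for c, and transporting it to V yields g. *)

(** * Bilinear forms as linear maps to the dual space *)

Section Forms.
Variable k : fieldType.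
Implicit Types (V W X Y : vectType k).

Lemma separating_functional V (A : {vspace V}) (z : V) :
  z \notin A -> exists2 f : 'Hom(V, k^o), f z = 1 & {in A, forall v, f v = 0}.
Proof.
move=> zA; pose w := z - projv A z.
have w0 : w != 0.
  by apply: contraNneq zA => /eqP; rewrite subr_eq0 => /eqP ->; apply: memv_proj.
have fr : free [tuple w] by rewrite seq1_free.
pose g : 'Hom(V, k^o) := linfun (coord [tuple w] ord0 : V -> k^o).
exists (g \o (\1 - projv A))%VF => [|v vA].
  rewrite comp_lfunE add_lfunE opp_lfunE id_lfunE -/w lfunE /=.
  by rewrite (coord_free ord0 ord0 fr).
rewrite comp_lfunE add_lfunE opp_lfunE id_lfunE projv_id // subrr linear0 //.
Qed.

Definition transpose V W (B : 'Hom(V, 'Hom(W, k^o))) : 'Hom(W, 'Hom(V, k^o)) :=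
  linfun (fun y : W => linfun (fun x : V => B x y) : 'Hom(V, k^o)).

Lemma transposeE V W (B : 'Hom(V, 'Hom(W, k^o))) y x : transpose B y x = B x y.
Proof.
have lin1 z : linear (fun x : V => B x z : k^o).
  by move=> a v w; rewrite linearP /= add_lfunE scale_lfunE.
have E1 z v : linfun (fun x : V => B x z : k^o) v = B v z.
  pose L := GRing.isLinear.Build _ _ _ _ _ (lin1 z).
  pose e : {linear V -> k^o} := HB.pack (fun x : V => B x z : k^o) L.
  exact: (lfunE e).
have lin2 : linear (fun y : W => linfun (fun x : V => B x y : k^o) : 'Hom(V, k^o)).
  by move=> a v w; apply/lfunP => t; rewrite add_lfunE scale_lfunE !E1 linearP.
pose L := GRing.isLinear.Build _ _ _ _ _ lin2.
pose e : {linear W -> 'Hom(V, k^o)} :=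
  HB.pack (fun y : W => linfun (fun x : V => B x y : k^o) : 'Hom(V, k^o)) L.
by rewrite /transpose (lfunE e) /= E1.
Qed.

Definition pullback V W X Y (B : 'Hom(V, 'Hom(W, k^o))) (f : 'Hom(X, V))
  (g : 'Hom(Y, W)) : 'Hom(X, 'Hom(Y, k^o)) :=
  transpose (transpose (B \o f) \o g)%VF.

Lemma pullbackE V W X Y (B : 'Hom(V, 'Hom(W, k^o))) (f : 'Hom(X, V))
  (g : 'Hom(Y, W)) x y : pullback B f g x y = B (f x) (g y).
Proof. by rewrite transposeE comp_lfunE transposeE comp_lfunE. Qed.

Lemma dim_subvs V (A : {vspace V}) : \dim {:subvs_of A} = \dim A.
Proof. by rewrite dimvf. Qed.

Lemma dim_dual V : \dim {:'Hom(V, k^o)} = \dim {:V}.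
Proof. by rewrite !dimvf /dim /= muln1. Qed.

Lemma form_onto V (B : 'Hom(V, 'Hom(V, k^o))) : lker B = 0%VS ->
  limg B = fullv.
Proof.
move=> B0; apply/eqP; rewrite eqEdim subvf dim_dual -(limg_ker_dim B fullv).
by rewrite B0 capv0 dimv0 add0n leqnn.
Qed.

(** Every form is obtained from a nondegenerate one by an endomorphism of its
first argument; adjoints, self-dualities and cosquares all arise in this way. *)
Lemma form_factor V (B C : 'Hom(V, 'Hom(V, k^o))) : lker B = 0%VS ->
  exists g : 'End(V), forall x y, C x y = B (g x) y.
Proof.
move=> B0; exists (B^-1 \o C)%VF => x y.
by rewrite comp_lfunE limg_lfunVK // form_onto ?memvf.
Qed.

Lemma lker_transpose V (B : 'Hom(V, 'Hom(V, k^o))) : lker B = 0%VS ->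
  lker (transpose B) = 0%VS.
Proof.
move=> B0; apply/eqP; rewrite -subv0; apply/subvP => y; rewrite memv_ker memv0.
apply: contraLR; rewrite -memv0 => /separating_functional[f fy _].
have /memv_imgP[x _ fE] : f \in limg B by rewrite form_onto ?memvf.
apply/eqP => /lfunP /(_ x); rewrite transposeE zero_lfunE -fE fy.
by move/eqP; rewrite oner_eq0.
Qed.

Lemma form_adjoint V (B : 'Hom(V, 'Hom(V, k^o))) (f : 'End(V)) :
  lker B = 0%VS -> exists g : 'End(V), forall x y, B (f x) y = B x (g y).
Proof.
move=> /lker_transpose B0.
have [g gE] := form_factor (transpose (B \o f)%VF) B0.
by exists g => x y; have := gE y x; rewrite !transposeE comp_lfunE.
Qed.

(** The annihilator is the kernel of the restriction of functionals to [A],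
which is onto. *)
Lemma dim_annihilator V (A : {vspace V}) :
  \dim (annihilator A) = (\dim {:V} - \dim A)%N.
Proof.
pose r := pullback (linfun id : 'End('Hom(V, k^o)))
            (\1%VF : 'End('Hom(V, k^o))) (linfun (vsval : subvs_of A -> V)).
have rE f x : r f x = f (vsval x).
  by rewrite pullbackE id_lfunE !lfunE.
have kerr : lker r = annihilator A.
  apply/vspaceP => f; rewrite memv_ker; apply/eqP/mem_annihilator => [f0 v vA | f0].
    by rewrite -(vsprojK vA) -rE f0 zero_lfunE.
  by apply/lfunP => x; rewrite rE zero_lfunE f0 // subvsP.
have imr : limg r = fullv.
  apply/vspaceP => g; rewrite memvf; apply/memv_imgP.
  exists (g \o linfun (vsproj A))%VF; first exact: memvf.
  by apply/lfunP => x; rewrite rE comp_lfunE lfunE /= vsvalK.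
have := limg_ker_dim r fullv; rewrite capfv kerr imr !dim_dual.
by rewrite dim_subvs => <-; rewrite addnK.
Qed.

Definition orthr V (B : 'Hom(V, 'Hom(V, k^o))) (A : {vspace V}) : {vspace V} :=
  (transpose B @^-1: annihilator A)%VS.

Lemma mem_orthr V (B : 'Hom(V, 'Hom(V, k^o))) (A : {vspace V}) y :
  reflect {in A, forall x, B x y = 0} (y \in orthr B A).
Proof.
rewrite -memv_preim; apply: (iffP (mem_annihilator _ _)) => H x xA.
  by have := H x xA; rewrite transposeE.
by rewrite transposeE H.
Qed.

Lemma dim_orthr V (B : 'Hom(V, 'Hom(V, k^o))) A : lker B = 0%VS ->
  \dim (orthr B A) = (\dim {:V} - \dim A)%N.
Proof.
move=> B0; have Bt0 := lker_transpose B0.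
rewrite -dim_annihilator -(lpreimK (f := transpose B) (W := annihilator A)).
  by rewrite limg_dim_eq // Bt0 capv0.
by rewrite form_onto ?subvf.
Qed.

Lemma orthr_transposeK V (B : 'Hom(V, 'Hom(V, k^o))) A : lker B = 0%VS ->
  orthr B (orthr (transpose B) A) = A.
Proof.
move=> B0; apply/esym/eqP; rewrite eqEdim; apply/andP; split.
  apply/subvP => y yA; apply/mem_orthr => x /mem_orthr /(_ y yA).
  by rewrite transposeE.
rewrite !dim_orthr ?lker_transpose // subKn //; exact/dimvS/subvf.
Qed.

End Forms.

(** * The trace form, and the parity of skew forms *)

Section Trace.
Variables (k : fieldType) (V : vectType k).
Let e := vbasis {:V}.
Let e_basis : basis_of fullv e := vbasisP fullv.
Let e_free : free e := basis_free e_basis.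

Definition ltrace (f : 'End(V)) : k := \tr (mxof e e f).

Fact ltrace_linear : linear (ltrace : 'End(V) -> k^o).
Proof. by move=> a f g; rewrite /ltrace linearP /= linearP. Qed.
HB.instance Definition _ :=
  GRing.isLinear.Build k 'End(V) k^o _ ltrace ltrace_linear.

Lemma ltrace_sum (I : Type) (r : seq I) (P : pred I) (F : I -> 'End(V)) :
  ltrace (\sum_(i <- r | P i) F i) = \sum_(i <- r | P i) ltrace (F i).
Proof. exact: (linear_sum (ltrace : {linear 'End(V) -> k^o})). Qed.

Lemma ltraceN f : ltrace (- f) = - ltrace f.
Proof. exact: (linearN (ltrace : {linear 'End(V) -> k^o})). Qed.

Lemma ltraceD f g : ltrace (f + g) = ltrace f + ltrace g.
Proof. exact: (linearD (ltrace : {linear 'End(V) -> k^o})). Qed.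

Lemma ltraceC (f g : 'End(V)) : ltrace (f \o g) = ltrace (g \o f).
Proof. by rewrite /ltrace !(mxof_comp _ _ e_basis) // mxtrace_mulC. Qed.

(** Testing against elementary matrices recovers the entries of [f]. *)
Lemma ltrace_nondegenerate (f : 'End(V)) :
  (forall g : 'End(V), ltrace (f \o g) = 0) -> f = 0.
Proof.
move=> f0; apply/eqP; rewrite -(mxof_eq0 e_basis e_basis).
apply/eqP/matrixP => i j; rewrite [RHS]mxE.
have := f0 (hommx e e (delta_mx j i)).
rewrite ltraceC /ltrace (mxof_comp _ _ e_basis) hommxK //.
move: (mxof _ _ _) => M; rewrite /mxtrace (bigD1 i) //= big1 => [|l li].
  rewrite !mxE (bigD1 j) //= big1 => [|l lj].
    by rewrite !mxE !eqxx mulr1 !addr0.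
  by rewrite !mxE (negPf lj) mulr0.
by rewrite !mxE big1 // => m _; rewrite !mxE (negPf li) andbF mulr0.
Qed.

Lemma functional_trace (phi : 'Hom('End(V), k^o)) :
  exists h : 'End(V), forall f, phi f = ltrace (f \o h).
Proof.
have lin1 (f : 'End(V)) : linear (fun g : 'End(V) => ltrace (g \o f) : k^o).
  by move=> a g h; rewrite comp_lfunDl -comp_lfunZl linearP.
have E1 f g : linfun (fun g : 'End(V) => ltrace (g \o f) : k^o) g
    = ltrace (g \o f).
  pose L := GRing.isLinear.Build _ _ _ _ _ (lin1 f).
  pose u : {linear 'End(V) -> k^o} :=
    HB.pack (fun g : 'End(V) => ltrace (g \o f) : k^o) L.
  exact: (lfunE u).
have lin2 : linear (fun f : 'End(V) =>
    linfun (fun g : 'End(V) => ltrace (g \o f) : k^o) : 'Hom('End(V), k^o)).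
  move=> a g h; apply/lfunP => t; rewrite add_lfunE scale_lfunE !E1.
  by rewrite comp_lfunDr -comp_lfunZr linearP.
pose L := GRing.isLinear.Build _ _ _ _ _ lin2.
pose u : {linear 'End(V) -> 'Hom('End(V), k^o)} := HB.pack (fun f : 'End(V) =>
    linfun (fun g : 'End(V) => ltrace (g \o f) : k^o) : 'Hom('End(V), k^o)) L.
have uE f g : linfun u f g = ltrace (g \o f) by rewrite lfunE E1.
have /form_onto u_onto : lker (linfun u) = 0%VS.
  apply/eqP; rewrite -subv0; apply/subvP => f; rewrite memv_ker memv0 => /eqP f0.
  apply/eqP/ltrace_nondegenerate => g.
  by rewrite ltraceC -uE f0 zero_lfunE.
have /memv_imgP[h _ ->] : phi \in limg (linfun u) by rewrite u_onto memvf.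
by exists h => f; rewrite uE.
Qed.

(** Such an [f] is nilpotent.  Rotating the projections onto the flag through
the trace gives its vanishing without eigenvalues, hence over any field. *)
Lemma ltrace_flag (f : 'End(V)) (A B : {vspace V}) :
    (B <= A)%VS -> (limg f <= A)%VS -> (f @: A <= B)%VS -> (f @: B <= 0)%VS ->
  ltrace f = 0.
Proof.
move=> BA fA fB f0.
have E1 : (projv A \o f = f)%VF.
  by apply/lfunP => v; rewrite comp_lfunE projv_id // (subvP fA) // memv_img ?memvf.
have E2 : (projv B \o (f \o projv A) = f \o projv A)%VF.
  apply/lfunP => v; rewrite comp_lfunE projv_id // comp_lfunE.
  by rewrite (subvP fB) // memv_img ?memv_proj.
have E3 : ((f \o projv A) \o projv B = 0)%VF.
  apply/lfunP => v; rewrite !comp_lfunE zero_lfunE.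
  have pB := memv_proj B v.
  rewrite [projv A _]projv_id ?(subvP BA) //; apply/eqP; rewrite -memv0.
  by rewrite (subvP f0) // memv_img.
by rewrite -E1 ltraceC -E2 ltraceC E3 linear0.
Qed.

End Trace.

Section Parity.
Variable k : fieldType.
Hypothesis char_k : 2%N \notin [pchar k].
Implicit Types (V : vectType k).

Lemma two_neq0 : 2%:R != 0 :> k.
Proof. by apply: contraNneq char_k => two0; rewrite inE /= two0 eqxx. Qed.

(** The Gram matrix satisfies [M^T = - M], so [\det M] equals [- \det M] in odd
dimension. *)
Lemma skew_form_even V (B : 'Hom(V, 'Hom(V, k^o))) :
  (forall x y, B x y = - B y x) -> lker B = 0%VS -> ~~ odd (\dim {:V}).
Proof.
move=> skewB kerB; pose e := vbasis {:V}.
have e_basis : basis_of fullv e := vbasisP fullv.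
pose M : 'M[k]_(\dim {:V}) := \matrix_(i, j) (B e`_i e`_j : k).
have M_free : row_free M.
  apply/row_freeP; exists (invmx M); apply: mulmxV.
  rewrite -row_free_unit -kermx_eq0; apply/rowV0P => u /sub_kermxP uM.
  have : vecof e u \in lker B.
    rewrite memv_ker; apply/eqP/lfunP => y; rewrite zero_lfunE.
    rewrite (coord_basis e_basis (memvf y)) linear_sum /= big1 // => j _.
    rewrite linearZ /= /vecof linear_sum /= sum_lfunE.
    have /matrixP /(_ 0 j) := uM; rewrite !mxE => uMj.
    rewrite (eq_bigr (fun i => u 0 i * M i j)) ?uMj ?scaler0 // => i _.
    by rewrite linearZ /= scale_lfunE mxE.
  by rewrite kerB memv0 vecof_eq0 // => /eqP.
have Mt : M^T = - M by apply/matrixP => i j; rewrite !mxE skewB.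
have : \det M != 0 by rewrite -unitfE -unitmxE -row_free_unit.
apply: contra => odd_n; have := det_tr M; rewrite Mt -scaleN1r detZ.
rewrite -signr_odd odd_n expr1 mulN1r => /eqP.
rewrite eq_sym -addr_eq0 -mulr2n -mulr_natl mulf_eq0 (negPf two_neq0).
by [].
Qed.

(** The form is nondegenerate on a complement of its kernel. *)
Lemma skew_form_rank_even V (B : 'Hom(V, 'Hom(V, k^o))) :
  (forall x y, B x y = - B y x) -> odd (\dim {:V}) = odd (\dim (lker B)).
Proof.
move=> skewB; pose S := (lker B)^C%VS.
pose i := linfun (vsval : subvs_of S -> V).
pose C := pullback B i i.
have CE x y : C x y = B (vsval x) (vsval y) by rewrite pullbackE !lfunE.
have /skew_form_even evenS : forall x y, C x y = - C y x.
  by move=> x y; rewrite !CE skewB.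
have : ~~ odd (\dim {:subvs_of S}).
  apply: evenS; apply/eqP; rewrite -subv0; apply/subvP => x.
  rewrite memv_ker memv0 => /eqP Cx; rewrite -(inj_eq val_inj) /= -memv0.
  rewrite -(capv_compl (lker B)) memv_cap subvsP andbT memv_ker.
  apply/eqP/lfunP => y; rewrite zero_lfunE.
  have : y \in (lker B + S)%VS by rewrite addv_complf memvf.
  case/memv_addP => z zK [s sS ->]; rewrite linearD /=.
  move: zK; rewrite memv_ker => /eqP zK.
  rewrite skewB zK zero_lfunE oppr0 add0r.
  by rewrite -(vsprojK sS) -CE Cx zero_lfunE.
rewrite dim_subvs dimv_compl.
have le := dimvS (subvf (lker B)).
by rewrite oddB //; case: (odd _); case: (odd _).
Qed.

End Parity.

(** * Fitting's lemma for representations *)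

Lemma bounded_stationary (d : nat -> nat) (b : nat) :
    (forall s, d s <= b)%N -> (forall s, d s <= d s.+1)%N ->
  exists s, d s = d s.+1.
Proof.
move=> db dS; have [/existsP[s /eqP ds]|] := boolP [exists s : 'I_b.+1, d s == d s.+1].
  by exists s.
rewrite negb_exists => /forallP neq.
have ge s : (s <= b.+1 -> s <= d s)%N.
  elim: s => // s IHs sb; rewrite (leq_ltn_trans (IHs (ltnW sb))) //.
  by rewrite ltn_neqAle dS andbT; exact: (neq (Ordinal sb)).
by have := ge b.+1 (leqnn _); rewrite ltnNge db.
Qed.

Section Powers.
Variables (k : fieldType) (V : vectType k).
Implicit Types f : 'End(V).

Definition lpow f N : 'End(V) := iter N (comp_lfun f) \1%VF.

Arguments lpow : simpl never.

Lemma lpowE f N v : lpow f N v = iter N f v.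
Proof.
rewrite /lpow; elim: N => [|N IH] /=; first by rewrite id_lfunE.
by rewrite comp_lfunE IH.
Qed.

Lemma iter_lfun0 f N : iter N f 0 = 0.
Proof. by rewrite -lpowE linear0. Qed.

Lemma iter_ker_stationary f :
  exists N, forall j v, iter (N + j) f v = 0 -> iter N f v = 0.
Proof.
have FS N : (lker (lpow f N) <= lker (lpow f N.+1))%VS.
  by apply/subvP => v; rewrite !memv_ker !lpowE /= => /eqP ->; rewrite linear0.
have [N dimN] : exists N, \dim (lker (lpow f N)) = \dim (lker (lpow f N.+1)).
  apply: (@bounded_stationary (fun N => \dim (lker (lpow f N))) (\dim {:V})) => N.
    exact/dimvS/subvf.
  exact/dimvS/FS.
have kerN : lker (lpow f N) = lker (lpow f N.+1).
  by apply/eqP; rewrite eqEdim FS dimN leqnn.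
exists N; elim=> [|j IH] v; first by rewrite addn0.
rewrite addnS iterSr => /IH; rewrite -iterSr -lpowE => /eqP.
by rewrite -memv_ker -kerN memv_ker lpowE => /eqP.
Qed.

End Powers.
Arguments lpow : simpl never.

Section Endomorphisms.
Variables (k : fieldType) (V : vectType k) (psi : linrep V).

Definition rep_end (f : 'End(V)) : Prop :=
  forall p v, v \in psi p -> f v \in psi p.

Lemma indecomposable_split (U1 U2 : {vspace V}) :
    indecomposable psi -> (U1 :&: U2 = 0)%VS -> (fullv <= U1 + U2)%VS ->
    (forall p, psi p <= psi p :&: U1 + psi p :&: U2)%VS ->
  U1 = 0%VS \/ U2 = 0%VS.
Proof.
move=> [_ indec] cap0 sumf dec.
have [->|U1n] := eqVneq U1 0%VS; first by left.
have [->|U2n] := eqVneq U2 0%VS; first by right.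
case: indec; exists U1, U2; split=> //.
- by apply/eqP; rewrite eqEsubv subvf.
- exact/directv_addP.
move=> p; split.
  by apply/eqP; rewrite eqEsubv dec subv_add !capvSl.
apply/directv_addP/eqP; rewrite -subv0 -cap0 subv_cap.
by rewrite (subv_trans (capvSl _ _)) ?capvSr // (subv_trans (capvSr _ _)) ?capvSr.
Qed.

(** For large [N] the kernel of [f ^ N] no longer grows, and V is the direct
sum of the kernel and the image of [f ^ N].  The same argument applied to each
[psi p], with the same [N], shows that this decomposition is one of
representations. *)
Lemma fitting (f : 'End(V)) : indecomposable psi -> rep_end f ->
  lker f = 0%VS \/ exists N, forall v, iter N f v = 0.
Proof.
move=> indec fE.
have [N ker_stable] := iter_ker_stationary f.
(* [f ^ N] is injective on its image, so it permutes the image of [A]. *)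
have FA (A : {vspace V}) : (forall v, v \in A -> f v \in A) ->
    (A <= A :&: lker (lpow f N) + A :&: limg (lpow f N))%VS.
  move=> fA; have FNA v : v \in A -> lpow f N v \in A.
    by rewrite lpowE => vA; elim: (N) => //= M; apply: fA.
  have FFA : (lpow f N @: (lpow f N @: A))%VS = (lpow f N @: A)%VS.
    apply/eqP; rewrite eqEdim; apply/andP; split.
      apply/subvP => _ /memv_imgP[_ /memv_imgP[v vA ->] ->].
      by rewrite memv_img // FNA.
    rewrite (@limg_dim_eq _ _ _ _ (lpow f N @: A)%VS) ?leqnn //.
    apply/eqP; rewrite -subv0; apply/subvP => v.
    rewrite memv_cap memv_ker => /andP[/memv_imgP[w wA ->]].
    rewrite !lpowE -iterD => /eqP /ker_stable ->; exact: mem0v.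
  apply/subvP => v vA.
  have : lpow f N v \in (lpow f N @: (lpow f N @: A))%VS by rewrite FFA memv_img.
  case/memv_imgP => _ /memv_imgP[w wA ->] Fv.
  rewrite -[v](subrK (lpow f N w)) memv_add // memv_cap; apply/andP; split.
  - by rewrite rpredB // FNA.
  - by rewrite memv_ker linearB /= Fv subrr.
  - exact: FNA.
  - by rewrite memv_img ?memvf.
have [|||U10|U20] := indecomposable_split (U1 := lker (lpow f N))
  (U2 := limg (lpow f N)) indec.
- apply/eqP; rewrite -subv0; apply/subvP => v.
  rewrite memv_cap memv_ker => /andP[/eqP Fv /memv_imgP[w _ vE]].
  move: Fv; rewrite vE !lpowE -iterD => /ker_stable ->; exact: mem0v.
- have := FA fullv; rewrite !capfv; apply=> v _; exact: memvf.
- move=> p; apply: FA => v; exact: fE.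
- left; apply/eqP; rewrite -subv0 -U10; apply/subvP => v.
  rewrite !memv_ker lpowE => /eqP fv; apply/eqP/(ker_stable 1%N).
  by rewrite addn1 iterSr fv iter_lfun0.
right; exists N => v; apply/eqP; rewrite -memv0 -U20 -lpowE; exact/memv_img/memvf.
Qed.

End Endomorphisms.

(** * A criterion for splitting off a subspace *)

Section LinearSystem.
Variables (k : fieldType) (V : vectType k) (P : finType).

(** A linear system is solvable as soon as its right-hand side is killed by
every functional killing its image; through the trace form these functionals
are tuples of endomorphisms. *)
Lemma fredholm (A B C : P -> 'End(V)) :
    (forall h : P -> 'End(V), \sum_p (B p \o (h p \o A p))%VF = 0 ->
       \sum_p ltrace (C p \o h p) = 0) ->
  exists r : 'End(V), forall p, (A p \o (r \o B p))%VF = C p.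
Proof.
move=> obstruction.
have Glin : linear (fun r : 'End(V) => [ffun p => (A p \o (r \o B p))%VF]).
  move=> a r s; apply/ffunP => p; rewrite !ffunE.
  by rewrite comp_lfunDl comp_lfunDr -comp_lfunZl -comp_lfunZr.
pose L := GRing.isLinear.Build _ _ _ _ _ Glin.
pose G : {linear 'End(V) -> {ffun P -> 'End(V)}} :=
  HB.pack (fun r : 'End(V) => [ffun p => (A p \o (r \o B p))%VF]) L.
have GE r p : linfun G r p = (A p \o (r \o B p))%VF by rewrite lfunE ffunE.
pose y := [ffun p => C p].
have [/memv_imgP[r _ yE]|] := boolP (y \in limg (linfun G)).
  by exists r => p; rewrite -GE -yE ffunE.
case/separating_functional => phi phiy phi0.
pose d p (X : 'End(V)) := [ffun q => if q == p then X else 0] : {ffun P -> 'End(V)}.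
have dlin p : linear (d p).
  move=> a X Y; apply/ffunP => q; rewrite !ffunE; case: eqP => // _.
  by rewrite scaler0 addr0.
have dE p X : linfun (d p) X = d p X.
  pose Ld := GRing.isLinear.Build _ _ _ _ _ (dlin p).
  pose D : {linear 'End(V) -> {ffun P -> 'End(V)}} := HB.pack (d p) Ld.
  exact: (lfunE D).
have ffun_sum (w : {ffun P -> 'End(V)}) : w = \sum_p d p (w p).
  apply/ffunP => q; rewrite sum_ffunE (bigD1 q) //= ffunE eqxx big1 ?addr0 // => p pq.
  by rewrite ffunE eq_sym (negPf pq).
have [h hE] := fin_all_exists (fun p => functional_trace (phi \o linfun (d p))%VF).
have phiE w : phi w = \sum_p ltrace (w p \o h p).
  rewrite {1}[w]ffun_sum linear_sum; apply: eq_bigr => p _.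
  by rewrite -hE comp_lfunE dE.
suff /obstruction sum0 : \sum_p (B p \o (h p \o A p))%VF = 0.
  move: phiy; rewrite phiE; under eq_bigr do rewrite ffunE.
  by rewrite sum0 => /eqP; rewrite eq_sym oner_eq0.
apply: ltrace_nondegenerate => r.
have -> : ((\sum_p (B p \o (h p \o A p))) \o r)%VF
    = \sum_p ((B p \o (h p \o A p)) \o r)%VF.
  apply/lfunP => v; rewrite comp_lfunE !sum_lfunE; apply: eq_bigr => p _.
  by rewrite [RHS]comp_lfunE.
rewrite ltrace_sum.
have := phi0 _ (memv_img (linfun G) (memvf r)); rewrite phiE; apply: etrans.
apply: eq_bigr => p _; rewrite GE !comp_lfunA -[RHS]/(ltrace _).
by rewrite -(comp_lfunA _ (B p) (h p)) [RHS]ltraceC !comp_lfunA.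
Qed.

End LinearSystem.

Lemma sum_P222 (G : zmodType) (F : P222 -> G) :
  \sum_p F p = \sum_j (F (j, false) + F (j, true)).
Proof.
transitivity (\sum_(p : 'I_3 * bool) F p); first by [].
rewrite (eq_bigr (fun p => F (p.1, p.2))) => [|[] //].
rewrite -(pair_bigA _ (fun j b => F (j, b))) /=.
by apply: eq_bigr => j _; rewrite big_bool addrC.
Qed.

Section Splitting.
Variables (k : fieldType) (V : vectType k) (psi : linrep V).

Local Notation I_ j := (psi (j, false)).
Local Notation C_ j := (psi (j, true)).

Lemma subIC j : (I_ j <= C_ j)%VS.
Proof. by apply: linrep_homo; rewrite P222_leE /= eqxx. Qed.

(** A retraction onto [L] preserving [psi] is [eL + eL r (1 - eL)], with [eL] a
projection onto [L] and [r] subject to linear equations.  By [fredholm] the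
obstruction to solving them is the trace on [L] of endomorphisms [x p] with
values in [psi p] and killing [psi p], whose sum maps [L] to itself.  Adding the
contributions of [i_j] and [c_j] gives maps [z j] sending V to [C_j], [C_j] to
[I_j] and [I_j] to 0.  Under the hypothesis each [z j] acts on [L], where it is
nilpotent along the flag [L :&: I_j <= L :&: C_j], so its trace is zero. *)
Lemma retraction_criterion (L : {vspace V}) :
    (forall z : 'I_3 -> 'End(V),
       (forall j, [/\ limg (z j) <= C_ j, z j @: C_ j <= I_ j &
                      z j @: I_ j <= 0]%VS) ->
       (forall v, v \in L -> \sum_j z j v \in L) ->
     forall j v, v \in L -> z j v \in L) ->
  exists r : 'End(V), [/\ rep_end psi r, forall v, r v \in L &
                           forall v, v \in L -> r v = v].
Proof.
move=> crit; pose e p := projv (psi p); pose eL := projv L.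
pose A p := ((\1 - e p) \o eL)%VF; pose B p := ((\1 - eL) \o e p)%VF.
pose C p := (- ((\1 - e p) \o (eL \o e p)))%VF.
have ABC (h : P222 -> 'End(V)) : \sum_p (B p \o (h p \o A p))%VF = 0 ->
    \sum_p ltrace (C p \o h p) = 0.
  move=> h0; pose x p := (e p \o (h p \o (\1 - e p)))%VF.
  have xim p v : x p v \in psi p by rewrite comp_lfunE memv_proj.
  have x0 p v : v \in psi p -> x p v = 0.
    move=> vp; rewrite !comp_lfunE add_lfunE opp_lfunE id_lfunE [e p v]projv_id //.
    by rewrite subrr !linear0.
  pose z j := (x (j, false) + x (j, true))%R.
  have zE j v : z j v = x (j, false) v + x (j, true) v by rewrite add_lfunE.
  have zflag j : [/\ limg (z j) <= C_ j, z j @: C_ j <= I_ j &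
                     z j @: I_ j <= 0]%VS.
    split; apply/subvP => _ /memv_imgP[v vp ->]; rewrite zE.
    - by rewrite rpredD ?xim // (subvP (subIC j)) ?xim.
    - by rewrite [x (j, true) v]x0 // addr0 xim.
    by rewrite !x0 ?addr0 ?mem0v // (subvP (subIC j)).
  have sumz v : \sum_j z j v = \sum_p x p v.
    by rewrite (eq_bigr _ (fun j _ => zE j v)) sum_P222.
  have zL v : v \in L -> \sum_j z j v \in L.
    move=> vL; rewrite sumz.
    move/lfunP/(_ v): h0; rewrite sum_lfunE zero_lfunE.
    rewrite (eq_bigr (fun p => (\1 - eL)%VF (x p v))) => [|p _]; last first.
      by rewrite !comp_lfunE [eL v]projv_id.
    rewrite -linear_sum /= add_lfunE opp_lfunE id_lfunE => /eqP.
    by rewrite subr_eq0 => /eqP ->; exact: memv_proj.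
  have zstable := crit z zflag zL.
  have trz j : ltrace (eL \o z j) = 0.
    have [zV zC zI] := zflag j.
    have eLz v : v \in L -> (eL \o z j \o eL)%VF v = z j v.
      by move=> vL; rewrite !comp_lfunE [eL v]projv_id // projv_id // zstable.
    have eL2 : (eL \o eL = eL)%VF by apply/lfunP => v; rewrite comp_lfunE projv_proj.
    rewrite -{1}eL2 -comp_lfunA ltraceC.
    apply: (ltrace_flag (A := (L :&: C_ j)%VS) (B := (L :&: I_ j)%VS)).
    - by rewrite capvS ?subIC.
    - apply/subvP => _ /memv_imgP[v _ ->]; rewrite !comp_lfunE memv_cap memv_proj /=.
      rewrite projv_id ?zstable ?memv_proj //.
      by rewrite (subvP zV) // memv_img ?memvf.
    - apply/subvP => _ /memv_imgP[v /memv_capP[vL vC] ->].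
      by rewrite eLz // memv_cap zstable //= (subvP zC) // memv_img.
    apply/subvP => _ /memv_imgP[v /memv_capP[vL vI] ->].
    by rewrite eLz // (subvP zI) // memv_img.
  rewrite (eq_bigr (fun p => - ltrace (eL \o x p))) => [|p _]; last first.
    rewrite /C comp_lfunNl ltraceN; congr (- _).
    by rewrite -comp_lfunA ltraceC -!comp_lfunA.
  rewrite sumrN; apply/eqP; rewrite oppr_eq0; apply/eqP.
  rewrite sum_P222 big1 // => j _.
  by rewrite -ltraceD -comp_lfunDr -/(z j) trz.
have [r rE] := fredholm ABC.
exists (eL + (eL \o (r \o (\1 - eL))))%VF; split=> [p v vp|v|v vL].
- have E1 : (\1 - e p)%VF (eL (r ((\1 - eL)%VF v))) = - (\1 - e p)%VF (eL v).
    have := congr1 (fun f : 'End(V) => f v) (rE p).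
    by rewrite /A /B /C /= opp_lfunE !comp_lfunE [e p v]projv_id.
  rewrite add_lfunE !comp_lfunE; set w := _ + _.
  have : (\1 - e p)%VF w = 0 by rewrite linearD /= E1 subrr.
  rewrite add_lfunE opp_lfunE id_lfunE => /eqP.
  by rewrite subr_eq0 => /eqP ->; exact: memv_proj.
- by rewrite add_lfunE rpredD ?comp_lfunE ?memv_proj.
rewrite add_lfunE !comp_lfunE add_lfunE opp_lfunE id_lfunE projv_id //.
by rewrite subrr !linear0 addr0.
Qed.

Lemma indecomposable_retraction (L : {vspace V}) (r : 'End(V)) :
    indecomposable psi -> rep_end psi r -> (forall v, r v \in L) ->
    (forall v, v \in L -> r v = v) ->
  L = 0%VS \/ L = fullv.
Proof.
move=> indec rE rL rid.
have [|||->|r0] := indecomposable_split (U1 := L) (U2 := lker r) indec.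
- apply/eqP; rewrite -subv0; apply/subvP => v.
  by rewrite memv_cap memv_ker => /andP[vL]; rewrite rid // memv0.
- apply/subvP => v _; rewrite -[v](subrK (r v)) addrC memv_add ?rL //.
  by rewrite memv_ker linearB /= [r (r v)]rid ?subrr.
- move=> p; apply/subvP => v vp; rewrite -[v](subrK (r v)) addrC memv_add //.
    by rewrite memv_cap rL rE.
  by rewrite memv_cap rpredB ?rE // memv_ker linearB /= [r (r v)]rid ?subrr.
- by left.
right; apply/vspaceP => v; rewrite memvf.
suff -> : v = r v by exact: rL.
apply/eqP; rewrite -subr_eq0 -memv0 -r0 memv_ker linearB /=.
by rewrite [r (r v)]rid ?subrr.
Qed.

End Splitting.

(** * The intersections of I_i with C_j *)

Lemma ord3_cases (i j : 'I_3) : [\/ j = i, j = i + 1 | j = i - 1].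
Proof.
case: i j => [[|[|[|//]]] hi] [[|[|[|//]]] hj];
by [constructor 1; apply: val_inj | constructor 2; apply: val_inj
   | constructor 3; apply: val_inj].
Qed.

Lemma ord3_addr2 (i : 'I_3) : i + 1 + 1 = i - 1.
Proof. by case: i => [[|[|[|//]]] hi]; apply: val_inj. Qed.

Lemma sum_ord3 (G : zmodType) (F : 'I_3 -> G) i :
  \sum_j F j = F i + F (i + 1) + F (i - 1).
Proof.
rewrite (reindex_inj (addrI i)) !big_ord_recl big_ord0 /= !addr0 addrA.
by congr (_ + _ + _); congr (F _); case: i => [[|[|[|//]]] hi]; apply: val_inj.
Qed.

Section CyclicChains.
Variables (k : fieldType) (V : vectType k) (psi : linrep V).
Variable b : 'Hom(V, 'Hom(V, k^o)).
Hypothesis indec : indecomposable psi.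
Hypothesis b_sym : forall x y, b x y = b y x.
Hypothesis b_nondeg : lker b = 0%VS.
Hypothesis b_perp :
  forall p y, y \in psi (P222_perp p) <-> (forall x, x \in psi p -> b x y = 0).

Local Notation I_ j := (psi (j, false)).
Local Notation C_ j := (psi (j, true)).

Lemma mem_C j y : y \in C_ j <-> (forall x, x \in I_ j -> b x y = 0).
Proof. exact: (b_perp (j, false) y). Qed.

Lemma form_IC j x y : x \in I_ j -> y \in C_ j -> b x y = 0.
Proof. by move=> xI /mem_C; apply. Qed.

Lemma dim_C j : (\dim (C_ j) = \dim {:V} - \dim (I_ j))%N.
Proof.
rewrite -(dim_orthr (I_ j) b_nondeg); congr (\dim _); apply/vspaceP => y.
by apply/idP/mem_orthr => [/mem_C|yC]; [|apply/mem_C].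
Qed.

(** The elements [x] of [I_ i] for which there are [x'] in [I_ (i - 1)],
[x''] in [I_ (i - 2)] and so on, ending with 0 after at most [s] steps, such
that [x - x'] is in [C_ (i + 1)], [x' - x''] in [C_ i], and so on. *)
Fixpoint chain (s : nat) (i : 'I_3) : {vspace V} :=
  if s is s'.+1 then (I_ i :&: (C_ (i + 1)%R + chain s' (i - 1)%R))%VS else 0%VS.

Lemma chainI s i : (chain s i <= I_ i)%VS.
Proof. by case: s => [|s]; rewrite ?sub0v ?capvSl. Qed.

Lemma chainS s i : (chain s i <= chain s.+1 i)%VS.
Proof.
elim: s i => [|s IH] i; first exact: sub0v.
by rewrite [chain s.+2 i]/= capvS // addvS // IH.
Qed.

Lemma chain_stationary : exists s, forall i, chain s i = chain s.+1 i.
Proof.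
have [s sE] : exists s, (\sum_i \dim (chain s i) = \sum_i \dim (chain s.+1 i))%N.
  apply: (@bounded_stationary (fun s => (\sum_i \dim (chain s i))%N)
    (\sum_(i < 3) \dim {:V})%N) => s.
    by apply: leq_sum => i _; exact/dimvS/subvf.
  by apply: leq_sum => i _; exact/dimvS/chainS.
exists s => i; apply/eqP; rewrite eqEdim chainS /=.
have le j : (\dim (chain s j) <= \dim (chain s.+1 j))%N by exact/dimvS/chainS.
move/eqP: sE; rewrite (bigD1 i) //= [X in _ == X](bigD1 i) //= => /eqP sE.
have rest : (\sum_(j | j != i) \dim (chain s j)
    <= \sum_(j | j != i) \dim (chain s.+1 j))%N by apply: leq_sum.
rewrite -(leq_add2r (\sum_(j | j != i) \dim (chain s.+1 j))).
by rewrite -[X in (X <= _)%N]sE leq_add2l.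
Qed.

(** Moving one step down both chains does not change [b x y] when [y] lies one
index after [x], and the shorter chain reaches 0 first. *)
Lemma chain_isotropic s t i j x y :
  x \in chain s i -> y \in chain t j -> b x y = 0.
Proof.
have next : forall s t i x y, x \in chain s i -> y \in chain t (i + 1) -> b x y = 0.
  elim=> [|{}s IH] {}t {}i {}x {}y.
    by rewrite memv0 => /eqP ->; rewrite linear0 zero_lfunE.
  case/memv_capP => _ /memv_addP[c cC [x' x'Z ->]] yZ.
  have yI := subvP (chainI _ _) _ yZ.
  rewrite linearD /= add_lfunE [b c y]b_sym (form_IC yI cC) add0r.
  case: t yZ => [|t]; first by rewrite memv0 => /eqP ->; rewrite linear0.
  case/memv_capP => _ /memv_addP[c' c'C [y' y'Z ->]].
  rewrite linearD /= (form_IC (j := i - 1)); first last.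
  - by rewrite -ord3_addr2.
  - exact: (subvP (chainI _ _) _ x'Z).
  rewrite add0r; apply: (IH t (i - 1)) => //.
  by rewrite subrK; rewrite addrK in y'Z.
case: (ord3_cases i j) => -> xZ yZ.
- apply: (form_IC (j := i)); first exact: (subvP (chainI s i)).
  by rewrite (subvP (subIC psi i)) // (subvP (chainI t i)).
- exact: next xZ yZ.
by rewrite b_sym; apply: (next t s (i - 1)) => //; rewrite subrK.
Qed.

(** The sum [L] of the stationary chain subspaces satisfies the hypothesis of
[retraction_criterion]: for [v] in [chain t l], the map [z l] kills [v], and
modulo [L] the two other values are opposite elements, one in [I_ (l + 1)], the
other in [C_ (l - 1)].  Such an element of [I_ (l + 1)] prolongs a chain, so it
lies in [L].  Thus [L] is a direct summand, and being isotropic it is 0. *)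
Lemma capI_next i : (I_ i :&: C_ (i + 1)%R = 0)%VS.
Proof.
have [s stable] := chain_stationary.
have chain_le t j : (chain t j <= chain s j)%VS.
  elim: t j => [|t IH] j; first exact: sub0v.
  by rewrite (stable j) /= capvS // addvS.
pose L := (\sum_i chain s i)%VS.
have ZL j : (chain s j <= L)%VS by rewrite (sumv_sup j).
have [|r [rE rL rid]] := @retraction_criterion _ _ psi L.
  move=> z zflag zL.
  suff zchain t l j v : v \in chain t l -> z j v \in L.
    move=> j v /memv_sumP[w wZ ->]; rewrite linear_sum memv_suml // => l _.
    exact: (zchain s l j (w l) (wZ l isT)).
  elim: t l j v => [|t IH] l j v.
    by rewrite memv0 => /eqP ->; rewrite linear0 mem0v.
  move=> vZ; have vL : v \in L by apply: (subvP (ZL l)); apply: (subvP (chain_le t.+1 l)).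
  have zl0 : z l v = 0.
    have [_ _ /subvP z0] := zflag l; apply/eqP; rewrite -memv0 z0 // memv_img //.
    exact: (subvP (chainI _ _) _ vZ).
  have znext : z (l + 1) v + z (l - 1) v \in L.
    by have := zL v vL; rewrite (sum_ord3 _ l) zl0 add0r.
  case/memv_capP: vZ => _ /memv_addP[c cC [w wZ vE]].
  have zwL j' : z j' w \in L by exact: IH wZ.
  have zcI : z (l + 1) c \in I_ (l + 1).
    by have [_ /subvP zC _] := zflag (l + 1); rewrite zC // memv_img.
  have zvC : z (l - 1) v \in C_ (l - 1).
    by have [/subvP zV _ _] := zflag (l - 1); rewrite zV // memv_img ?memvf.
  have zcL : z (l + 1) c \in L.
    have : z (l + 1) c + z (l - 1) v \in L.
      rewrite -(addrK (z (l + 1) w) (_ + _)) rpredB //.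
      by rewrite addrAC -linearD /= -vE.
    case/memv_sumP => y yZ; rewrite (sum_ord3 _ l) => yE.
    have yI m : y m \in I_ m by exact: (subvP (chainI _ _) _ (yZ m isT)).
    have : z (l + 1) c - y (l + 1) \in chain s.+1 (l + 1).
      rewrite /= memv_cap rpredB //= ord3_addr2 addrK.
      have -> : z (l + 1) c - y (l + 1) = (y (l - 1) - z (l - 1) v) + y l.
        rewrite -[z (l + 1) c](addrK (z (l - 1) v)) yE.
        by rewrite addrAC [_ + y (l - 1)]addrC addrA addrK -!addrA [y l + _]addrC addrA.
      rewrite memv_add ?yZ // rpredB //.
      exact: (subvP (subIC psi _)).
    rewrite -stable => /(subvP (ZL _)) yL.
    by rewrite -[z (l + 1) c](subrK (y (l + 1))) rpredD ?yL // (subvP (ZL (l + 1))) ?yZ.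
  have z1 : z (l + 1) v \in L by rewrite vE linearD /= rpredD.
  case: (ord3_cases l j) => ->; rewrite ?zl0 ?mem0v //.
  by rewrite -(addKr (z (l + 1) v) (z (l - 1) v)) addrC rpredB.
have [L0|LV] := indecomposable_retraction indec rE rL rid.
  apply/eqP; rewrite -subv0 -L0 (subv_trans _ (ZL i)) //.
  by rewrite (subv_trans _ (chain_le 1%N i)) //= addv0.
case: indec => /negP[]; rewrite -subv0 -b_nondeg; apply/subvP => x _.
rewrite memv_ker; apply/eqP/lfunP => y; rewrite zero_lfunE.
have : x \in L by rewrite LV memvf.
have : y \in L by rewrite LV memvf.
case/memv_sumP => y' y'Z -> /memv_sumP[x' x'Z ->].
rewrite linear_sum big1 // => m _; rewrite linear_sum /= sum_lfunE big1 // => l _.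
exact: chain_isotropic (x'Z l isT) (y'Z m isT).
Qed.

(** [capI_next] bounds the dimension of [I_ l] by that of [I_ (l + 1)], and the
indices are cyclic. *)
Lemma dim_I_eq i j : \dim (I_ i) = \dim (I_ j).
Proof.
have le l : (\dim (I_ l) <= \dim (I_ (l + 1)%R))%N.
  have := dimvS (subvf (I_ l + C_ (l + 1)%R)%VS).
  have := dimvS (subvf (I_ (l + 1))).
  rewrite dimv_disjoint_sum ?capI_next // dim_C => dimI.
  by rewrite addnBA // leq_subLR leq_add2r.
have le1 l : (\dim (I_ (l + 1)%R) <= \dim (I_ l))%N.
  apply: leq_trans (le _) _; apply: leq_trans (le _) _.
  by rewrite ord3_addr2 addrK leqnn.
have eq1 l : \dim (I_ (l + 1)%R) = \dim (I_ l) by apply/eqP; rewrite eqn_leq le1 le.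
case: (ord3_cases i j) => -> //; rewrite ?eq1 //.
by rewrite -{1}(subrK 1 i) eq1.
Qed.

Lemma addv_IC i j : i != j -> (I_ i + C_ j = fullv)%VS.
Proof.
have next l : (I_ l + C_ (l + 1)%R = fullv)%VS.
  apply/eqP; rewrite eqEdim subvf dimv_disjoint_sum ?capI_next // dim_C.
  by rewrite (dim_I_eq (l + 1) l) subnKC ?leqnn //; exact/dimvS/subvf.
case: (ord3_cases i j) => ->; rewrite ?eqxx //.
move=> _; apply/eqP; rewrite eqEdim subvf /=.
have cap0 : (I_ i :&: C_ (i - 1)%R = 0)%VS.
  apply/eqP; rewrite -subv0 -b_nondeg; apply/subvP => v /memv_capP[vI vC].
  rewrite memv_ker; apply/eqP/lfunP => y; rewrite zero_lfunE.
  have : y \in (I_ (i - 1)%R + C_ (i - 1 + 1)%R)%VS by rewrite next memvf.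
  rewrite subrK => /memv_addP[x xI [c cC ->]].
  by rewrite linearD /= (form_IC vI cC) b_sym (form_IC xI vC) addr0.
rewrite dimv_disjoint_sum // dim_C (dim_I_eq (i - 1) i) subnKC ?leqnn //.
exact/dimvS/subvf.
Qed.

Lemma capv_IC i j : i != j -> (I_ i :&: C_ j = 0)%VS.
Proof.
move=> ij; apply/eqP; rewrite -dimv_eq0.
have := dimv_sum_cap (I_ i) (C_ j); rewrite addv_IC // dim_C (dim_I_eq j i).
rewrite subnKC; last exact/dimvS/subvf.
by rewrite -{2}[\dim {:V}]addn0 => /addnI ->.
Qed.

End CyclicChains.

(** * Jordan blocks adapted to a pair of subspaces *)

Section RankOne.
Variables (k : fieldType) (V : vectType k).

Definition rank_one (f : 'Hom(V, k^o)) (w : V) : 'End(V) :=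
  linfun (fun v => (f v : k) *: w).

Lemma rank_oneE f w v : rank_one f w v = (f v : k) *: w.
Proof.
have lin : linear (fun v => (f v : k) *: w).
  by move=> a x y; rewrite linearP scalerDl scalerA.
pose L := GRing.isLinear.Build _ _ _ _ _ lin.
pose e : {linear V -> V} := HB.pack (fun v => (f v : k) *: w) L.
exact: (lfunE e).
Qed.

End RankOne.

(** Take a nonzero [z] in [K] (in [lker T] if [K = 0]) divisible by the highest
possible power [T ^ m], say [z = T ^ m x], and a functional [f] with [f z = 1]
vanishing on the image of [T ^ (m + 1)].  The map
[r v = \sum_i f (T ^ (m - i) v) T ^ i x] has its image in the Jordan block
spanned by the [T ^ i x], and it fixes [z].  It commutes with [T] because [f]
kills [T ^ (m + 1)], and it preserves [M] if either [x] is in [M] or [f]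
vanishes on [T ^ m M]; one of the two can be arranged, according to whether [z]
is in [T ^ m M].  If [r] is injective, the block is all of [X]. *)
Lemma jordan_block_endomorphism (k : fieldType) (X : vectType k) (T : 'End(X))
    (K M : {vspace X}) :
    lker T != 0%VS -> (K <= lker T)%VS -> (limg T <= M)%VS ->
  exists r : 'End(X),
    [/\ forall v, r (T v) = T (r v),
        (r @: K <= K)%VS, (r @: M <= M)%VS,
        exists2 z, z != 0 & r z = z &
        lker r = 0%VS ->
          \dim (lker T) = 1%N /\ exists N, forall v, iter N T v = 0].
Proof.
move=> kerT KT TM.
pose K' := if K == 0%VS then lker T else K.
have K'n0 : K' != 0%VS by rewrite /K'; case: ifP => // ->.
have K'T : (K' <= lker T)%VS by rewrite /K'; case: ifP.
(* [T] is injective on the image of a high power of [T]. *)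
have exQ : exists m, (K' :&: limg (lpow T m))%VS == 0%VS.
  have [N stable] := iter_ker_stationary T.
  exists N; rewrite -subv0; apply/subvP => y /memv_capP[zK /memv_imgP[w _ zE]].
  move: zK; rewrite zE => /(subvP K'T); rewrite memv_ker !lpowE -iterS -addn1.
  by move/eqP/stable => ->; exact: mem0v.
have [[|m] /eqP capSm minQ] := ex_minnP exQ.
  move: K'n0; rewrite -subv0 -capSm subv_cap subvv /= => /negP[].
  by apply/subvP => v _; rewrite -[v](id_lfunE v) memv_img ?memvf.
have capm : (K' :&: limg (lpow T m))%VS != 0%VS.
  by apply/negP => /minQ; rewrite ltnn.
have [z zn0 [zK' zim]] : exists2 z, z != 0 & z \in K' /\ z \in limg (lpow T m).
  exists (vpick (K' :&: limg (lpow T m))%VS); first by rewrite vpick0.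
  exact/memv_capP/memv_pick.
have Tz : T z = 0 by apply/eqP; rewrite -memv_ker (subvP K'T).
have znim : z \notin limg (lpow T m.+1).
  by apply: contra zn0 => zim1; rewrite -memv0 -capSm memv_cap zK'.
have [x [f [xz fz fim fM]]] : exists x, exists f : 'Hom(X, k^o),
   [/\ iter m T x = z, f z = 1, forall v, f (iter m.+1 T v) = 0 &
       x \in M \/ forall v, v \in M -> f (iter m T v) = 0].
  have [zM|zM] := boolP (z \in (lpow T m @: M)%VS).
    have [f fz f0] := separating_functional znim.
    case/memv_imgP: zM => x xM xz; exists x, f; split=> //; last by left.
    - by rewrite xz lpowE.
    - by move=> v; rewrite f0 // -lpowE memv_img ?memvf.
  have [f fz f0] := separating_functional zM.
  case/memv_imgP: zim => x _ xz; exists x, f; split=> //.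
  - by rewrite xz lpowE.
  - by move=> v; rewrite iterSr f0 // -lpowE memv_img ?(subvP TM) ?memv_img ?memvf.
  - by right => v vM; rewrite f0 // -lpowE memv_img.
pose r : 'End(X) := \sum_(i < m.+1)
  rank_one (f \o lpow T (m - i))%VF (iter i T x).
have rE v : r v = \sum_(i < m.+1) (f (iter (m - i) T v) : k) *: iter i T x.
  by rewrite sum_lfunE; apply: eq_bigr => i _; rewrite rank_oneE comp_lfunE lpowE.
have rker v : T v = 0 -> r v = (f v : k) *: z.
  move=> Tv; rewrite rE big_ord_recr /= subnn xz big1 ?add0r // => i _.
  by rewrite -subnSK // iterSr Tv iter_lfun0 linear0 scale0r.
have rz : r z = z by rewrite rker // fz scale1r.
exists r; split.
- move=> v; rewrite !rE linear_sum big_ord_recl big_ord_recr /=.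
  rewrite subn0 -iterSr fim scale0r add0r linearZ /= -[T (iter m T x)]/(iter m.+1 T x).
  rewrite iterS xz Tz scaler0 addr0; apply: eq_bigr => i _.
  by rewrite linearZ /= /bump add1n -iterSr subnSK.
- apply/subvP => _ /memv_imgP[v vK ->].
  rewrite rker; last by apply/eqP; rewrite -memv_ker (subvP KT).
  move: zK'; rewrite /K'; case: eqP => [K0 _|_ zK]; last exact: memvZ.
  by move: vK; rewrite K0 memv0 => /eqP ->; rewrite linear0 scale0r mem0v.
- apply/subvP => _ /memv_imgP[v vM ->]; rewrite rE big_ord_recl /= subn0 rpredD //.
    by case: fM => [xM|->] //; [exact: memvZ | rewrite scale0r mem0v].
  apply: rpred_sum => i _; apply/memvZ/(subvP TM).
  by rewrite memv_img ?memvf.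
- by exists z.
move=> r0; have rim v : exists w, v = r w.
  have : v \in limg r by rewrite lker0_limgf ?r0 ?memvf.
  by case/memv_imgP => w _ ->; exists w.
split; last first.
  exists m.+1 => v; have [w ->] := rim v.
  rewrite -lpowE rE linear_sum big1 // => i _; rewrite linearZ /= lpowE -iterD addnC.
  by rewrite iterD iterS xz Tz iter_lfun0 scaler0.
apply/eqP; rewrite eqn_leq lt0n dimv_eq0 kerT andbT.
have le : (\dim {:X} <= \dim (<[x]> + limg T)%VS)%N.
  apply: dimvS; apply/subvP => v _; have [w ->] := rim v.
  rewrite rE big_ord_recl /= memv_add ?memvZ ?memv_line //.
  by apply: rpred_sum => i _; apply/memvZ; rewrite memv_img ?memvf.
have := limg_ker_dim T fullv; rewrite capfv => dimT.
have := leq_trans le (dimv_add_leqif _ _); rewrite -dimT leq_add2r => /leq_trans; apply.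
by rewrite dim_vline; case: (_ != _).
Qed.

(** * Normal form: a single bilinear form on I_0 *)

Lemma ord3_split (j : 'I_3) : [\/ j = 0, j = 1 | j = -1].
Proof.
by case: (ord3_cases 0 j) => ->; rewrite ?add0r;
  [constructor 1 | constructor 2 | constructor 3].
Qed.

Section NormalForm.
Variables (k : fieldType) (V : vectType k) (psi : linrep V).
Variable b : 'Hom(V, 'Hom(V, k^o)).
Hypothesis indec : indecomposable psi.
Hypothesis b_sym : forall x y, b x y = b y x.
Hypothesis b_nondeg : lker b = 0%VS.
Hypothesis b_perp :
  forall p y, y \in psi (P222_perp p) <-> (forall x, x \in psi p -> b x y = 0).

Local Notation I_ j := (psi (j, false)).
Local Notation C_ j := (psi (j, true)).

Let capIC i j : i != j -> (I_ i :&: C_ j = 0)%VS.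
Proof. exact: capv_IC. Qed.
Let addIC i j : i != j -> (I_ i + C_ j = fullv)%VS.
Proof. exact: addv_IC. Qed.
Let dimI i j : \dim (I_ i) = \dim (I_ j).
Proof. exact: dim_I_eq. Qed.
Let form0 j x y : x \in I_ j -> y \in C_ j -> b x y = 0.
Proof. exact: form_IC. Qed.
Let formII j x y : x \in I_ j -> y \in I_ j -> b x y = 0.
Proof. by move=> xI yI; apply: (form0 xI); apply: (subvP (subIC psi j)). Qed.

(** The sign makes [v + transit i j v] lie in [C_ j]; on [I_ l], with [l] the
third index, this is an isomorphism onto [I_ i]. *)
Definition transit (i j : 'I_3) : 'End(V) := (- daddv_pi (I_ i) (C_ j))%R.

Lemma transit_I i j v : transit i j v \in I_ i.
Proof. by rewrite opp_lfunE rpredN memv_pi. Qed.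

Lemma transit_C i j v : i != j -> v + transit i j v \in C_ j.
Proof.
move=> ij; rewrite opp_lfunE.
have vE := daddv_pi_add (capIC ij) (_ : v \in I_ i + C_ j)%VS.
by rewrite -{1}vE ?addIC ?memvf // addrAC subrr add0r memv_pi.
Qed.

Local Notation X := (subvs_of (I_ 0)).

Definition coordinate (j : 'I_3) : 'Hom(X, V) :=
  ((if j == 0 then \1 else if j == 1 then transit 1 (-1) else transit (-1) 1)
   \o linfun (vsval : X -> V))%VF.

Local Notation e := coordinate.

Lemma coordinate0 x : e 0 x = vsval x.
Proof. by rewrite comp_lfunE /= id_lfunE lfunE. Qed.

Lemma coordinate_I j x : e j x \in I_ j.
Proof.
by case: (ord3_split j) => ->; rewrite comp_lfunE /= ?transit_I // id_lfunE lfunE subvsP.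
Qed.

Lemma coordinate1_C x : e 0 x + e 1 x \in C_ (-1).
Proof.
by rewrite coordinate0 comp_lfunE /= [linfun _ x]lfunE transit_C.
Qed.

Lemma coordinate2_C x : e 0 x + e (-1) x \in C_ 1.
Proof.
by rewrite coordinate0 comp_lfunE /= [linfun _ x]lfunE transit_C.
Qed.

Lemma coordinate_inj j x : e j x = 0 -> x = 0.
Proof.
move=> ejx; apply/val_inj/eqP => /=; rewrite -memv0 -coordinate0.
have [E|E|E] := ord3_split j; rewrite E in ejx.
- by rewrite ejx mem0v.
- rewrite -(@capIC 0 (-1)) // memv_cap coordinate_I /=.
  by have := coordinate1_C x; rewrite ejx addr0.
rewrite -(@capIC 0 1) // memv_cap coordinate_I /=.
by have := coordinate2_C x; rewrite ejx addr0.
Qed.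

Lemma lker_coordinate j : lker (e j) = 0%VS.
Proof.
apply/eqP; rewrite -subv0; apply/subvP => x; rewrite memv_ker memv0.
by move/eqP/coordinate_inj ->.
Qed.

Lemma limg_coordinate j : limg (e j) = I_ j.
Proof.
apply/eqP; rewrite eqEdim; apply/andP; split.
  by apply/subvP => _ /memv_imgP[x _ ->]; apply: coordinate_I.
by rewrite limg_dim_eq ?lker_coordinate ?capv0 // dim_subvs (dimI j 0) leqnn.
Qed.

Lemma coordinate_onto j v : v \in I_ j -> exists x, v = e j x.
Proof. by rewrite -limg_coordinate => /memv_imgP[x _ ->]; exists x. Qed.

Definition core_form := pullback b (e 0) (e 1).
Local Notation c := core_form.

Lemma gram01 x y : b (e 0 x) (e 1 y) = c x y.
Proof. by rewrite pullbackE. Qed.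

Lemma gram12 x y : b (e 1 x) (e (-1) y) = - c y x.
Proof.
apply/eqP; rewrite -addr_eq0 -gram01 [b (e 0 y) _]b_sym -linearD /= addrC.
apply/eqP; apply: form0 (coordinate2_C y); exact: coordinate_I.
Qed.

Lemma gram02 x y : b (e 0 x) (e (-1) y) = c y x.
Proof.
apply/eqP; rewrite -subr_eq0 -gram12 -add_lfunE -linearD /= b_sym; apply/eqP.
exact: form0 (coordinate_I (-1) y) (coordinate1_C x).
Qed.

(** An element of [I_ 0] orthogonal to all of [I_ 1] lies in [C_ 1]. *)
Lemma core_nondeg : lker c = 0%VS.
Proof.
apply/eqP; rewrite -subv0; apply/subvP => x; rewrite memv_ker memv0 => /eqP cx.
apply/eqP/(@coordinate_inj 0)/eqP; rewrite -memv0 -(@capIC 0 1) // memv_cap.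
rewrite coordinate_I /=; apply/(mem_C b_perp) => _ /coordinate_onto[y ->].
by rewrite b_sym gram01 cx zero_lfunE.
Qed.

Lemma core_inj_l x x' : (forall y, c x y = c x' y) -> x = x'.
Proof.
move=> E; apply/eqP; rewrite -subr_eq0 -memv0 -core_nondeg memv_ker linearB /=.
by rewrite subr_eq0; apply/eqP/lfunP.
Qed.

Lemma core_inj_r y y' : (forall x, c x y = c x y') -> y = y'.
Proof.
move=> E; apply/eqP; rewrite -subr_eq0 -memv0 -(lker_transpose core_nondeg).
rewrite memv_ker linearB /= subr_eq0; apply/eqP/lfunP => x.
by rewrite [LHS]transposeE [RHS]transposeE E.
Qed.

Lemma cosquare_exists : exists u : 'End(X), forall x y, c (u x) y = - c y x.
Proof.
have [u uE] := form_factor (- transpose c)%R core_nondeg.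
by exists u => x y; rewrite -uE !opp_lfunE transposeE.
Qed.

Variable u : 'End(X).
Hypothesis uE : forall x y, c (u x) y = - c y x.

(** Its kernel [K] measures the failure of the sum of the three [I_ j] to be
direct, and its values on the fixed space of the cosquare are the vectors of
that sum orthogonal to it. *)
Definition coordinate_sum : 'Hom(X, V) := (e 0 + e 1 + e (-1))%R.
Local Notation K := (lker coordinate_sum).

Lemma coordinate_sumE x : coordinate_sum x = e 0 x + e 1 x + e (-1) x.
Proof. by rewrite !add_lfunE. Qed.

Definition span_I := (I_ 0%R + I_ 1%R + I_ (-1)%R)%VS.
Local Notation U := span_I.

Lemma sub_span_I j : (I_ j <= U)%VS.
Proof.
rewrite /span_I; case: (ord3_split j) => ->; rewrite ?addvSr //.
  by rewrite -addvA addvSl.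
exact: subv_trans (addvSr _ _) (addvSl _ _).
Qed.

Lemma formUr v x y z :
  v = e 0 x + e 1 y + e (-1) z ->
  forall w, [/\ b v (e 0 w) = c w y + c z w, b v (e 1 w) = c x w - c z w &
                b v (e (-1) w) = c w x - c w y].
Proof.
move=> -> w; rewrite !linearD /= !add_lfunE; split.
- rewrite (formII (coordinate_I 0 x) (coordinate_I 0 w)) add0r.
  by rewrite ![b _ (e 0 w)]b_sym gram01 gram02.
- rewrite (formII (coordinate_I 1 y) (coordinate_I 1 w)) addr0.
  by rewrite gram01 [b (e (-1) z) _]b_sym gram12.
by rewrite (formII (coordinate_I (-1) z) (coordinate_I (-1) w)) addr0 gram02 gram12.
Qed.

(** The equations expressing orthogonality to [I_ (-1)] and [I_ 1] equate the
coordinates; orthogonality to [I_ 0] then says that [x] is fixed by the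
cosquare. *)
Lemma radical_span v x y z :
    v = e 0 x + e 1 y + e (-1) z -> (forall j w, b v (e j w) = 0) ->
  [/\ y = x, z = x & u x = x].
Proof.
move=> vE v0; have F := formUr vE.
have yx : y = x.
  apply: core_inj_r => w; apply/esym/eqP; rewrite -subr_eq0.
  by have [_ _ <-] := F w; rewrite v0.
have zx : z = x.
  apply: core_inj_l => w; apply/esym/eqP; rewrite -subr_eq0.
  by have [_ <- _] := F w; rewrite v0.
split=> //; apply: core_inj_l => w; rewrite uE; apply/esym/eqP.
by rewrite -addr_eq0 addrC; have [+ _ _] := F w; rewrite v0 yx zx => <-.
Qed.

Lemma coordinate_sum_radical x j w : u x = x -> b (coordinate_sum x) (e j w) = 0.
Proof.
move=> ux; have [F0 F1 F2] := formUr (coordinate_sumE x) w.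
case: (ord3_split j) => ->; rewrite ?F0 ?F1 ?F2 ?subrr //.
by rewrite -{2}ux uE subrr.
Qed.

Lemma K_fixed x : x \in K -> u x = x.
Proof.
rewrite memv_ker coordinate_sumE => /eqP x0.
by have [|] := radical_span (esym x0) => // j w; rewrite linear0 zero_lfunE.
Qed.

Lemma orthr_span_I : (orthr b U <= U)%VS ->
  orthr b U = (coordinate_sum @: lker (u - \1%VF))%VS.
Proof.
move=> UU; apply/vspaceP => v; apply/idP/idP => [vU|].
  have [_ /memv_addP[_ /coordinate_onto[x ->] [_ /coordinate_onto[y ->] ->]]
    [_ /coordinate_onto[z ->] vE]] := memv_addP (subvP UU v vU).
  have [|yx zx ux] := radical_span vE.
    move=> j w; rewrite b_sym; move/mem_orthr: vU; apply.
    by rewrite (subvP (sub_span_I j)) // coordinate_I.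
  rewrite vE yx zx -coordinate_sumE memv_img // memv_ker add_lfunE opp_lfunE id_lfunE.
  by rewrite ux subrr.
case/memv_imgP => x; rewrite memv_ker add_lfunE opp_lfunE id_lfunE subr_eq0.
move=> /eqP ux ->; apply/mem_orthr => w.
case/memv_addP => _ /memv_addP[_ /coordinate_onto[w0 ->] [_ /coordinate_onto[w1 ->] ->]].
case=> _ /coordinate_onto[w2 ->] ->.
by rewrite b_sym !linearD /= !coordinate_sum_radical ?addr0.
Qed.

(** [I_ 0] and [I_ 1] are independent, and their sum meets [I_ (-1)] in a copy
of [K]. *)
Lemma dim_span_I : (\dim U + \dim K = 3 * \dim {:X})%N.
Proof.
have I01 : (I_ 0%R :&: I_ 1%R = 0)%VS.
  by apply/eqP; rewrite -subv0 -(@capIC 0 1) // capvS // subIC.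
have capK : ((I_ 0%R + I_ 1%R) :&: I_ (-1)%R = e (-1)%R @: K)%VS.
  apply/vspaceP => v; apply/memv_capP/idP.
    case=> /memv_addP[_ /coordinate_onto[x ->] [_ /coordinate_onto[y ->] vE]].
    move=> /coordinate_onto[z vz].
    have [||yx zx _] := @radical_span 0 x y (- z).
    - by rewrite linearN /= -vz vE subrr.
    - by move=> j w; rewrite linear0 zero_lfunE.
    rewrite vz; apply: memv_img; rewrite -rpredN zx memv_ker coordinate_sumE.
    by rewrite -zx [e (-1) _]linearN /= -vz vE yx zx subrr.
  case/memv_imgP => x; rewrite memv_ker coordinate_sumE addr_eq0 => /eqP xE ->.
  split; last exact: coordinate_I.
  by rewrite -rpredN -xE memv_add ?coordinate_I.
have := dimv_sum_cap (I_ 0%R + I_ 1%R)%VS (I_ (-1)).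
rewrite -/U capK dimv_disjoint_sum // limg_dim_eq ?lker_coordinate ?capv0 // => ->.
by rewrite (dimI 1 0) (dimI (-1) 0) dim_subvs !mulSn mul0n addn0 addnA.
Qed.

(** The dimension of V is the sum of those of [U] and of its orthogonal, and
[\dim K] occurs in both with the same sign. *)
Lemma odd_dim : (orthr b U <= U)%VS ->
  odd (\dim {:V}) = odd (\dim {:X}) (+) odd (\dim (lker (u - \1%VF))).
Proof.
move=> UU; have := dim_orthr U b_nondeg.
rewrite orthr_span_I //; have := limg_ker_dim coordinate_sum (lker (u - \1%VF)).
have -> : (lker (u - \1%VF) :&: K = K)%VS.
  apply/capv_idPr/subvP => x /K_fixed ux.
  by rewrite memv_ker add_lfunE opp_lfunE id_lfunE ux subrr.
move=> <- E; rewrite -(subnK (dimvS (subvf U))) -E oddD [odd (\dim K + _)]oddD.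
have := congr1 odd dim_span_I; rewrite oddM oddD /= => <-.
by do 3 case: (odd _).
Qed.

End NormalForm.

(** * Extending endomorphisms of I_0 to V *)

Lemma sum_ord3_0 (G : zmodType) (F : 'I_3 -> G) :
  \sum_j F j = F 0 + F 1 + F (-1).
Proof. by rewrite (sum_ord3 _ 0) !add0r. Qed.

Lemma fitting_fixed (k : fieldType) (V : vectType k) (psi : linrep V)
    (f : 'End(V)) z :
    indecomposable psi -> rep_end psi f -> z != 0 -> f z = z ->
  lker f = 0%VS.
Proof.
move=> indec fE z0 fz; case: (fitting indec fE) => // -[N nil].
have := nil z; suff -> : iter N f z = z by move=> E; rewrite E eqxx in z0.
by elim: N {nil} => //= N ->.
Qed.

Section Transport.
Variables (k : fieldType) (V : vectType k) (psi : linrep V).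
Variable b : 'Hom(V, 'Hom(V, k^o)).
Hypothesis indec : indecomposable psi.
Hypothesis b_sym : forall x y, b x y = b y x.
Hypothesis b_nondeg : lker b = 0%VS.
Hypothesis b_perp :
  forall p y, y \in psi (P222_perp p) <-> (forall x, x \in psi p -> b x y = 0).

Local Notation I_ j := (psi (j, false)).
Local Notation C_ j := (psi (j, true)).
Local Notation X := (subvs_of (I_ 0)).
Local Notation e := (coordinate psi).
Local Notation c := (core_form psi b).
Local Notation K := (lker (coordinate_sum psi)).
Local Notation U := (span_I psi).

Let formU := formUr indec b_sym b_nondeg b_perp.
Let onto := coordinate_onto indec b_sym b_nondeg b_perp.

Lemma rep_end_adjoint (h h' : 'End(V)) :
  (forall x y, b (h x) y = b x (h' y)) -> rep_end psi h -> rep_end psi h'.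
Proof.
move=> adj hE p y; rewrite -{1 2}(P222_perpK p) => yp.
apply/b_perp => x xp; rewrite -adj; move/b_perp: yp; apply; exact: hE.
Qed.

Variable u : 'End(X).
Hypothesis uE : forall x y, c (u x) y = - c y x.

(** Two coordinate vectors of the same element of [U] differ by a diagonal one
with entries in [K], so acting by [r] on each coordinate is well defined. *)
Lemma coordinatewise (r : 'End(X)) : (r @: K <= K)%VS ->
  exists H : 'End(V), forall j x, H (e j x) = e j (r x).
Proof.
move=> rK.
have slin : linear (fun t : {ffun 'I_3 -> X} => \sum_j e j (t j)).
  move=> a t s; rewrite scaler_sumr -big_split /=; apply: eq_bigr => j _.
  by rewrite !ffunE linearP.
have [eps epsE] : exists eps : 'Hom({ffun 'I_3 -> X}, V),
    forall t, eps t = \sum_j e j (t j).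
  pose L := GRing.isLinear.Build _ _ _ _ _ slin.
  pose E : {linear {ffun 'I_3 -> X} -> V} :=
    HB.pack (fun t : {ffun 'I_3 -> X} => \sum_j e j (t j)) L.
  by exists (linfun E) => t; rewrite lfunE.
have Hlin : linear (fun v => \sum_j e j (r ((eps^-1)%VF v j))).
  move=> a v w; rewrite scaler_sumr -big_split /=; apply: eq_bigr => j _.
  by rewrite linearP !ffunE !linearP.
have [H HE] : exists H : 'End(V),
    forall v, H v = \sum_j e j (r ((eps^-1)%VF v j)).
  pose L := GRing.isLinear.Build _ _ _ _ _ Hlin.
  pose E : {linear V -> V} := HB.pack (fun v => \sum_j e j (r ((eps^-1)%VF v j))) L.
  by exists (linfun E) => t; rewrite lfunE.
exists H => j x; rewrite HE.
pose d : {ffun 'I_3 -> X} := [ffun l => if l == j then x else 0].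
have sumd (g : 'End(X)) : \sum_l e l (g (d l)) = e j (g x).
  rewrite (bigD1 j) //= ffunE eqxx big1 ?addr0 // => l lj.
  by rewrite ffunE (negPf lj) !linear0.
have epsd : eps d = e j x.
  have := sumd \1%VF; rewrite id_lfunE epsE => <-.
  by apply: eq_bigr => l _; rewrite id_lfunE.
set t := (eps^-1)%VF _.
have epst : eps t = eps d by rewrite /t -epsd limg_lfunVK // memv_img ?memvf.
pose s := t - d; have sE l : s l = t l - d l by rewrite !ffunE.
have eps0 : 0 = e 0 (s 0) + e 1 (s 1) + e (-1) (s (-1)).
  by rewrite -(sum_ord3_0 (fun l => e l (s l))) -epsE linearB /= epst subrr.
have [|s1 s2 _] := radical_span indec b_sym b_nondeg b_perp uE eps0.
  by move=> l w; rewrite linear0 zero_lfunE.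
have rs0 : r (s 0) \in K.
  rewrite s1 s2 in eps0.
  by rewrite (subvP rK) // memv_img // memv_ker coordinate_sumE -eps0.
apply/eqP; rewrite -(sumd r) -subr_eq0 -sumrB.
rewrite (eq_bigr (fun l => e l (r (s l)))) => [|l _]; last first.
  by rewrite sE !linearB.
by rewrite sum_ord3_0 s1 s2 -coordinate_sumE -memv_ker.
Qed.

(** On [U], with projection [p], the extension is the coordinatewise action [H]
of [r], whose adjoint there is the coordinatewise action [H'] of [r'].  On the
complement of [U] it is taken to be the adjoint [G] of [H' p]; then [h] is
adjoint to [H'] against all of [U], which is what makes it preserve the [C_ j],
the orthogonals of the [I_ j]. *)
Lemma transport (r r' : 'End(X)) :
    (forall x y, c (r x) y = c x (r' y)) -> (forall x, r (u x) = u (r x)) ->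
    (r @: K <= K)%VS -> (r' @: K <= K)%VS ->
  exists h h' : 'End(V),
    [/\ rep_end psi h, rep_end psi h', forall v w, b (h v) w = b v (h' w),
        forall x, h (e 0 x) = e 0 (r x) & forall x, h' (e 0 x) = e 0 (r' x)].
Proof.
move=> adj ru rK r'K.
(* As [r] commutes with the cosquare, its right and left adjoints coincide. *)
have adj' x y : c y (r x) = c (r' y) x.
  by rewrite -[LHS]opprK -uE -ru adj uE opprK.
have [H HE] := coordinatewise rK; have [H' HE'] := coordinatewise r'K.
have spanU v : v \in U -> exists x y z, v = e 0 x + e 1 y + e (-1) z.
  case/memv_addP => _ /memv_addP[_ /onto[x ->] [_ /onto[y ->] ->]].
  by case=> _ /onto[z ->] ->; exists x, y, z.
have HH v w : v \in U -> w \in U -> b (H v) w = b v (H' w).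
  move=> /spanU[x [y [z vE]]] /spanU[x' [y' [z' ->]]].
  have HvE : H v = e 0 (r x) + e 1 (r y) + e (-1) (r z).
    by rewrite vE !linearD /= !HE.
  rewrite !linearD /= !HE'.
  have [-> _ _] := formU HvE x'; have [_ -> _] := formU HvE y'.
  have [_ _ ->] := formU HvE z'.
  have [-> _ _] := formU vE (r' x'); have [_ -> _] := formU vE (r' y').
  have [_ _ ->] := formU vE (r' z').
  by rewrite !adj !adj'.
pose p := projv U.
have [G GE] := form_adjoint (H' \o p)%VF b_nondeg.
pose h := ((H \o p) + (G \o (\1 - p)))%VF.
have hv v : h v = H (p v) + G (v - p v).
  by rewrite add_lfunE !comp_lfunE [(\1 - p)%VF v]add_lfunE opp_lfunE id_lfunE.
have hE v w : w \in U -> b (h v) w = b v (H' w).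
  move=> wU; rewrite hv linearD /= add_lfunE.
  rewrite HH ?memv_proj // [b (G _) w]b_sym -GE comp_lfunE [p w]projv_id //.
  rewrite [b (H' w) _]b_sym -add_lfunE -linearD /=.
  by rewrite addrC subrK.
have he j x : h (e j x) = e j (r x).
  have eU : e j x \in U by rewrite (subvP (sub_span_I psi j)) // coordinate_I.
  by rewrite hv [p _]projv_id // subrr linear0 addr0 HE.
have [h' adjh] := form_adjoint h b_nondeg.
have hrep : rep_end psi h.
  move=> [j []] v vp; last first.
    by have [x ->] := onto vp; rewrite he coordinate_I.
  apply/(mem_C b_perp) => _ /onto[x ->]; rewrite b_sym hE; last first.
    by rewrite (subvP (sub_span_I psi j)) // coordinate_I.
  by rewrite HE' b_sym (form_IC b_perp (coordinate_I _ _) vp).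
exists h, h'; split=> //; first exact: rep_end_adjoint adjh hrep.
move=> x; have eU : e 0 x \in U by rewrite (subvP (sub_span_I psi 0)) // coordinate_I.
apply/eqP; rewrite -subr_eq0 -memv0 -b_nondeg memv_ker linearB /= subr_eq0.
by apply/eqP/lfunP => v; rewrite b_sym -adjh hE // HE' b_sym.
Qed.

(** Applied to [T], to [K] and to the left orthogonal [M] of [K], the lemma
[jordan_block_endomorphism] gives an [r] whose adjoint preserves [K] because
[r] preserves [M].  Its extension to V fixes a nonzero vector, hence is
injective, and so is [r]. *)
Lemma core_block (a : k) (T := (u - a *: \1%VF)%R) :
    lker T != 0%VS -> (K <= lker T)%VS ->
    (forall x y, y \in K -> c (T x) y = 0) ->
  \dim (lker T) = 1%N /\ exists N, forall v, iter N T v = 0.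
Proof.
have c0 := core_nondeg indec b_sym b_nondeg b_perp.
move=> kerT KT TK; pose M := orthr (transpose c) K.
have TM : (limg T <= M)%VS.
  apply/subvP => _ /memv_imgP[x _ ->]; apply/mem_orthr => y yK.
  by rewrite transposeE TK.
have [r [rT rK rM [z z0 rz] concl]] := jordan_block_endomorphism kerT KT TM.
have ru x : r (u x) = u (r x).
  have := rT x; rewrite !add_lfunE !opp_lfunE !scale_lfunE !id_lfunE.
  by rewrite linearB linearZ /= => /addIr.
have [r' adj] := form_adjoint r c0.
have r'K : (r' @: K <= K)%VS.
  apply/subvP => _ /memv_imgP[y yK ->]; rewrite -(orthr_transposeK K c0).
  apply/mem_orthr => m mM; rewrite -adj.
  have /mem_orthr/(_ y yK) : r m \in M by rewrite (subvP rM) // memv_img.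
  by rewrite transposeE.
have [h [h' [hrep _ _ he _]]] := transport adj ru rK r'K.
have einj := coordinate_inj indec b_sym b_nondeg b_perp (j := 0).
have h0 : lker h = 0%VS.
  apply: (fitting_fixed indec hrep (z := e 0 z)); last by rewrite he rz.
  by apply: contra z0 => /eqP/einj ->.
apply: concl; apply/eqP; rewrite -subv0; apply/subvP => x.
rewrite memv_ker memv0 => /eqP rx; apply/eqP/einj/eqP.
by rewrite -memv0 -h0 memv_ker he rx linear0.
Qed.

End Transport.

(** * A skew automorphism in even dimension *)

Lemma nilpotent_eigen0 (k : fieldType) (X : vectType k) (T : 'End(X)) N a x :
  (forall v, iter N T v = 0) -> T x = a *: x -> a != 0 -> x = 0.
Proof.
move=> nil Tx a0; have itE M : iter M T x = a ^+ M *: x.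
  by elim: M => [|M IH]; rewrite ?scale1r //= IH linearZ /= Tx scalerA exprSr.
have /eqP := nil x; rewrite itE scaler_eq0 expf_eq0 (negPf a0) andbF.
by move/eqP.
Qed.

Section SkewElement.
Variables (k : fieldType) (V : vectType k) (psi : linrep V).
Variable b : 'Hom(V, 'Hom(V, k^o)).
Hypothesis char_k : 2%N \notin [pchar k].
Hypothesis indec : indecomposable psi.
Hypothesis b_sym : forall x y, b x y = b y x.
Hypothesis b_nondeg : lker b = 0%VS.
Hypothesis b_perp :
  forall p y, y \in psi (P222_perp p) <-> (forall x, x \in psi p -> b x y = 0).
Hypothesis even_V : ~~ odd (\dim {:V}).

Local Notation I_ j := (psi (j, false)).
Local Notation X := (subvs_of (I_ 0)).
Local Notation e := (coordinate psi).
Local Notation c := (core_form psi b).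
Local Notation K := (lker (coordinate_sum psi)).
Local Notation U := (span_I psi).

(** If [y] is orthogonal to [U] but not in [U], some [y'] orthogonal to [U]
has [b y' y = 1].  The map [v |-> b y' v *: y] kills every [I_ j], has its image
in every [C_ j], and fixes [y], so it is injective and V is a line,
against the parity of its dimension. *)
Lemma orthr_span_I_sub : (orthr b U <= U)%VS.
Proof.
apply: contraT => /subvPn[y yU' yU].
have [f fy fU] := separating_functional yU.
have /memv_imgP[y' _ fE] : f \in limg b by rewrite form_onto ?memvf.
have y0 : y != 0 by apply: contraNneq yU => ->; exact: mem0v.
have y'I j v : v \in I_ j -> b y' v = 0.
  by move=> vI; rewrite -fE fU // (subvP (sub_span_I psi j)).
have gE : rep_end psi (rank_one (b y') y).
  move=> [j []] v vp; rewrite rank_oneE; last by rewrite (y'I j) // scale0r mem0v.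
  apply/memvZ/(mem_C b_perp) => x xI; move/mem_orthr: yU'; apply.
  by rewrite (subvP (sub_span_I psi j)).
have g0 : lker (rank_one (b y') y) = 0%VS.
  by apply: (fitting_fixed indec gE y0); rewrite rank_oneE -fE fy scale1r.
have : (\dim {:V} <= 1)%N.
  rewrite -(limg_dim_eq (f := rank_one (b y') y)) ?g0 ?capv0 //.
  apply: leq_trans (dimvS _) (_ : \dim <[y]> <= 1)%N.
    by apply/subvP => _ /memv_imgP[v _ ->]; rewrite rank_oneE memvZ ?memv_line.
  by rewrite dim_vline; case: (_ != _).
have [V0 _] := indec; move: even_V V0; rewrite -dimv_eq0.
by case: (\dim _) => [|[|]].
Qed.

Lemma skew_element : exists g : 'End(V),
  [/\ rep_end psi g, lker g = 0%VS & forall v w, b (g v) w = - b v (g w)].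
Proof.
have two0 := two_neq0 char_k.
have [u uE] := cosquare_exists indec b_sym b_nondeg b_perp.
have c0 := core_nondeg indec b_sym b_nondeg b_perp.
have UU := orthr_span_I_sub.
have Kfix := K_fixed indec b_sym b_nondeg b_perp uE.
have oddV := odd_dim indec b_sym b_nondeg b_perp uE UU.
rewrite (negPf even_V) in oddV.
have u1E x : (u - \1%VF)%R x = u x - x by rewrite add_lfunE opp_lfunE id_lfunE.
have u2E x : (u - (-1) *: \1%VF)%R x = u x + x.
  by rewrite add_lfunE opp_lfunE scale_lfunE id_lfunE scaleN1r opprK.
pose sk := (c - transpose c)%R.
have skE x y : sk x y = c x y - c y x.
  by rewrite add_lfunE opp_lfunE add_lfunE opp_lfunE [transpose c x y]transposeE.
have kersk : lker sk = lker (u - (-1) *: \1%VF).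
  apply/vspaceP => x; rewrite !memv_ker u2E; apply/eqP/eqP => [x0|x0].
    apply: (core_inj_l indec b_sym b_nondeg b_perp) => y.
    rewrite linear0 zero_lfunE linearD /= add_lfunE uE addrC -skE x0 zero_lfunE //.
  by apply/lfunP => y; rewrite skE -(uE x y) -add_lfunE -linearD /= addrC x0 linear0.
have oddX : odd (\dim {:X}) = odd (\dim (lker (u - (-1) *: \1%VF))).
  by rewrite -kersk; apply: (skew_form_rank_even char_k) => x y; rewrite !skE opprB.
(* Otherwise [u - 1] is nilpotent with a line as kernel; then [u + 1] is
   injective, [X] has even dimension and V odd dimension. *)
have inj1 : lker (u - \1%VF) = 0%VS.
  apply/eqP; apply: contraT => ker1.
  have := @core_block _ _ _ _ indec b_sym b_nondeg b_perp u uE 1.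
  rewrite scale1r => /(_ ker1) [||dim1 [N nil]].
  - by apply/subvP => x /Kfix ux; rewrite memv_ker u1E ux subrr.
  - move=> x y /Kfix uy; have cyx : c y x = - c x y by rewrite -uE uy.
    by rewrite u1E linearB /= add_lfunE opp_lfunE uE cyx opprK subrr.
  move: oddV oddX; rewrite dim1 addbT => /esym/negbFE ->.
  rewrite (_ : lker _ = 0%VS) ?dimv0 //; apply/eqP; rewrite -subv0.
  apply/subvP => x; rewrite memv_ker memv0 u2E addr_eq0 => /eqP ux.
  apply/eqP; apply: (nilpotent_eigen0 (a := - 2%:R) nil); last by rewrite oppr_eq0.
  by rewrite u1E ux -opprD -mulr2n scaleNr scaler_nat.
have K0 : K = 0%VS.
  apply/eqP; rewrite -subv0 -inj1; apply/subvP => x /Kfix ux.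
  by rewrite memv_ker u1E ux subrr.
move: oddV; rewrite inj1 dimv0 addbF => /esym evenX.
(* Otherwise the kernel of [u + 1] is a line and [X] has odd dimension. *)
have inj2 : lker (u - (-1) *: \1%VF) = 0%VS.
  apply/eqP; apply: contraT => ker2.
  have [||dim1 _] := @core_block _ _ _ _ indec b_sym b_nondeg b_perp u uE (-1) ker2.
  - by rewrite K0 sub0v.
  - by move=> x y; rewrite K0 memv0 => /eqP ->; rewrite linear0.
  by move: oddX; rewrite dim1 evenX.
have u_inj : lker u = 0%VS.
  apply/eqP; rewrite -subv0; apply/subvP => x; rewrite memv_ker memv0 => /eqP ux.
  apply/eqP/(core_inj_r indec b_sym b_nondeg b_perp) => y.
  by rewrite linear0; apply: oppr_inj; rewrite -uE ux linear0 zero_lfunE oppr0.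
have uK : cancel u (u^-1)%VF by apply: lker0_lfunK; apply/eqP.
have uVK : cancel (u^-1)%VF u by apply: lker0_lfunVK; apply/eqP.
(* [u] is an isometry of [c], so [u - u^-1] is skew; it is injective since
   [u ^ 2 - 1] is. *)
pose t := (u - u^-1%VF)%R.
have tE x : t x = u x - (u^-1)%VF x by rewrite add_lfunE opp_lfunE.
have adj x y : c (t x) y = c x ((- t)%R y).
  have cuu v w : c (u v) (u w) = c v w by rewrite !uE opprK.
  rewrite opp_lfunE !tE opprB !linearB /= add_lfunE opp_lfunE.
  congr (_ - _); first by rewrite -[in LHS](uVK y) cuu.
  by rewrite -cuu uVK.
have tu x : t (u x) = u (t x) by rewrite !tE linearB /= uK uVK.
have [||h [h' [hE hE' hh' he he']]] :=
  transport indec b_sym b_nondeg b_perp uE adj tu.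
- by rewrite K0 limg0 sub0v.
- by rewrite K0 limg0 sub0v.
have gE v : (h - h')%R v = h v - h' v by rewrite add_lfunE opp_lfunE.
have grep : rep_end psi (h - h')%R by move=> p v vp; rewrite gE rpredB ?hE ?hE'.
have t_inj x : t x = 0 -> x = 0.
  rewrite tE => /eqP; rewrite subr_eq0 => /eqP ux.
  have : u x + x \in lker (u - \1%VF).
    by rewrite memv_ker u1E linearD /= {1}ux uVK [x + _]addrC subrr.
  rewrite inj1 memv0 -u2E -memv_ker inj2 memv0.
  by move/eqP.
have [x x0] : exists x : X, x != 0.
  exists (vpick {:X}); rewrite vpick0 -dimv_eq0; apply/negP => /eqP X0.
  have dimU := dim_span_I indec b_sym b_nondeg b_perp uE.
  have U0 : \dim U = 0%N.
    by apply/eqP; move/eqP: dimU; rewrite X0 muln0 addn_eq0 => /andP[].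
  have := dimvS UU; rewrite dim_orthr // U0 subn0 leqn0 dimv_eq0.
  by case: indec => /negPf ->.
(* [h] and its adjoint [h'] act on [I_ 0] as [t] and [- t], so the difference
   acts as [2 t] and cannot be nilpotent. *)
have g0 : lker (h - h')%R = 0%VS.
  case: (fitting indec grep) => // -[N nil].
  have gN M y : iter M (h - h')%R (e 0 y) = 2%:R ^+ M *: e 0 (iter M t y).
    elim: M y => [|M IH] y; first by rewrite scale1r.
    rewrite iterS IH linearZ /= gE he he' opp_lfunE linearN opprK -mulr2n.
    by rewrite -scaler_nat scalerA -exprSr.
  have := nil (e 0 x); rewrite gN => /eqP; rewrite scaler_eq0 expf_eq0.
  rewrite (negPf two0) andbF /= => /eqP.
  move/(coordinate_inj indec b_sym b_nondeg b_perp) => tN.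
  case/eqP: x0; elim: N {nil gN} tN => //= N IH /t_inj; exact: IH.
exists (h - h')%R; split=> // v w.
have bBl : b (h v - h' v) w = b (h v) w - b (h' v) w.
  by rewrite linearB /= add_lfunE opp_lfunE.
have bBr : b v (h w - h' w) = b v (h w) - b v (h' w) by rewrite linearB.
rewrite !gE bBl bBr hh' opprB; congr (_ - _).
by rewrite b_sym -hh' b_sym.
Qed.

End SkewElement.

(** * Compatible forms and the theorem *)

Lemma symplectic_from_lfun (k : fieldType) (V : vectType k) (psi : linrep V)
    (B : 'Hom(V, 'Hom(V, k^o))) :
    2%N \notin [pchar k] -> (forall x y, B x y = - B y x) -> lker B = 0%VS ->
    (forall p y, y \in psi (P222_perp p) <-> forall x, x \in psi p -> B x y = 0) ->
  exists omega : {skew_symmetric V}, is_psymplectic omega /\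
    exists phi : symprep omega, symprep_linrep phi =1 psi.
Proof.
move=> char_k skewB B0 perpB.
pose f (x y : V) : k := B x y.
have f_bil : bilinear_for *%R *%R f.
  split=> v a x y; rewrite /f linearP // add_lfunE scale_lfunE //.
have f_skew x y : f x y = (-1) ^+ true * idfun (f y x).
  by rewrite /f /= expr1 mulN1r skewB.
have f_bil' : bilinear_for *%R (idfun \; *%R) f := f_bil.
pose F1 := bilinear_isBilinear.Build k V V k *%R *%R f f_bil.
pose F2 := isHermitianSesquilinear.Build k V true idfun f f_skew.
pose omega : {skew_symmetric V} := HB.pack f F1 F2.
have omegaE x y : omega x y = B x y by [].
have perp_omega p : psi (P222_perp p) = orthov omega (psi p).
  apply/vspaceP => y; apply/idP/mem_orthovP => [/perpB yp x xp|y0].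
    by rewrite omegaE skewB yp ?oppr0.
  by apply/perpB => x xp; rewrite skewB -omegaE y0 ?oppr0.
exists omega; split; last by exists (SympRep perp_omega).
split; [|by []|by rewrite (negPf char_k)].
rewrite /nondegenerate -subv0 -B0; apply/subvP => x /mem_orthovP x0.
rewrite memv_ker; apply/eqP/lfunP => y.
by rewrite zero_lfunE -omegaE x0 ?memvf.
Qed.

Lemma lfun_of_form (k : fieldType) (V : vectType k) (omega : {skew_symmetric V}) :
  exists B : 'Hom(V, 'Hom(V, k^o)), forall x y, B x y = omega x y.
Proof.
have lin1 x : linear (omega x : V -> k^o) by move=> a v w; rewrite linearPr.
have E1 x y : linfun (omega x : V -> k^o) y = omega x y.
  pose L := GRing.isLinear.Build _ _ _ _ _ (lin1 x).
  pose e : {linear V -> k^o} := HB.pack (omega x : V -> k^o) L.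
  exact: (lfunE e).
have lin2 : linear (fun x => linfun (omega x : V -> k^o)).
  move=> a v w; apply/lfunP => y; rewrite add_lfunE scale_lfunE !E1.
  by rewrite linearPl.
pose L := GRing.isLinear.Build _ _ _ _ _ lin2.
pose e : {linear V -> 'Hom(V, k^o)} :=
  HB.pack (fun x => linfun (omega x : V -> k^o)) L.
by exists (linfun e) => x y; rewrite lfunE E1.
Qed.

Lemma perp_of_dim (k : fieldType) (V : vectType k) (psi : linrep V)
    (B : 'Hom(V, 'Hom(V, k^o))) :
    lker B = 0%VS ->
    (forall p x y, x \in psi p -> y \in psi (P222_perp p) -> B x y = 0) ->
    (forall p, \dim (psi (P222_perp p)) = \dim {:V} - \dim (psi p))%N ->
  forall p y, y \in psi (P222_perp p) <-> forall x, x \in psi p -> B x y = 0.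
Proof.
move=> B0 Bp dimp p y.
suff -> : psi (P222_perp p) = orthr B (psi p) by split=> /mem_orthr.
apply/eqP; rewrite eqEdim dimp dim_orthr // leqnn andbT.
by apply/subvP => z zp; apply/mem_orthr => x xp; exact: Bp zp.
Qed.

Theorem corollary2p1 (k : fieldType) (k_perfect : perfect_field k)
    (char_k : 2%N \notin [pchar k]) (V : vectType k) (psi : linrep V)
    (psi_indec : indecomposable psi) :
  (exists omega : {skew_symmetric V}, is_psymplectic omega /\
     exists phi : symprep omega, symprep_linrep phi =1 psi)
  <-> (self_dual psi /\ ~~ odd (\dim {:V})).
Proof.
split=> [[omega [[nondeg _ _] [phi phiE]]]|[[f [f' fK f'K] fpsi] even_V]].
  have [B BE] := lfun_of_form omega.
  have skewB x y : B x y = - B y x by rewrite !BE hermC expr1 mulN1r.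
  have B0 : lker B = 0%VS.
    apply/eqP; rewrite -subv0; apply/subvP => x; rewrite memv_ker => /eqP x0.
    rewrite -(eqP nondeg); apply/mem_orthovP => y _.
    by rewrite -BE x0 zero_lfunE.
  split; last exact: (skew_form_even char_k skewB).
  exists B => [|p].
    exists (B^-1)%VF => x; first by rewrite lker0_lfunK ?B0.
    by rewrite limg_lfunVK // form_onto ?memvf.
  apply/vspaceP => g; apply/memv_imgP/mem_annihilator => [[x xp ->] y yp|g0].
    move: yp; rewrite skewB -!phiE symprep_perp => /mem_orthovP yp.
    by rewrite BE yp ?oppr0 // phiE.
  have /memv_imgP[x _ gE] : g \in limg B by rewrite form_onto ?memvf.
  exists x => //; rewrite -phiE -(P222_perpK p) symprep_perp.
  by apply/mem_orthovP => y yp; rewrite -BE -gE g0 // -phiE.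
have f0 : lker f = 0%VS by apply/eqP/lker0P; exact: can_inj fK.
have f_perp p x y : x \in psi p -> y \in psi (P222_perp p) -> f x y = 0.
  move=> xp yp; have : f x \in annihilator (psi (P222_perp p)).
    by rewrite -[annihilator _](fpsi p) memv_img.
  by move/mem_annihilator; apply.
have dim_perp p : (\dim (psi (P222_perp p)) = \dim {:V} - \dim (psi p))%N.
  rewrite -{2}(P222_perpK p) -dim_annihilator -[annihilator _](fpsi (P222_perp p)).
  by rewrite limg_dim_eq // f0 capv0.
have symp_of (B : 'Hom(V, 'Hom(V, k^o))) :
    lker B = 0%VS -> (forall x y, B x y = - B y x) ->
    (forall p x y, x \in psi p -> y \in psi (P222_perp p) -> B x y = 0) ->
  exists omega : {skew_symmetric V}, is_psymplectic omega /\
     exists phi : symprep omega, symprep_linrep phi =1 psi.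
  move=> B0 skewB B_perp; apply: (symplectic_from_lfun char_k skewB B0).
  exact: perp_of_dim.
have f_perp' p x y : x \in psi p -> y \in psi (P222_perp p) -> f y x = 0.
  by move=> xp yp; apply: (f_perp _ _ _ yp); rewrite P222_perpK.
have tfE x y : transpose f x y = f y x by exact: transposeE.
have [a aE] := form_factor (transpose f) f0.
have a_rep : rep_end psi a.
  move=> p x xp.
  have : f (a x) \in (f @: psi p)%VS.
    rewrite fpsi; apply/mem_annihilator => y yp.
    by rewrite -aE tfE (f_perp' p).
  by case/memv_imgP => x' x'p /(can_inj fK) ->.
have aEf x : f (a x) = transpose f x by apply/lfunP => y; rewrite aE.
have one_rep : rep_end psi (\1 - a)%VF.
  by move=> p x xp; rewrite add_lfunE opp_lfunE id_lfunE rpredB ?a_rep.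
(* Either [1 - a] is injective and the skew part of [f] is nondegenerate, or
   [1 - a] is nilpotent and the symmetric part is. *)
have [inj1|[N nil]] := fitting psi_indec one_rep.
  apply: (symp_of (f - transpose f)) => [|x y|p x y xp yp].
  - apply/eqP; rewrite -subv0 -inj1; apply/subvP => x; rewrite memv_ker.
    rewrite add_lfunE opp_lfunE -aEf -linearB -(linear0 f) => /eqP/(can_inj fK) ax.
    by rewrite memv_ker add_lfunE opp_lfunE id_lfunE ax.
  - by rewrite !add_lfunE !opp_lfunE !tfE opprB.
  by rewrite !add_lfunE !opp_lfunE !tfE (f_perp p x y) ?(f_perp' p x y) ?subrr.
pose b := f + transpose f.
have bE x y : b x y = f x y + f y x by rewrite !add_lfunE tfE.
have b_sym x y : b x y = b y x by rewrite !bE addrC.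
have b0 : lker b = 0%VS.
  apply/eqP; rewrite -subv0; apply/subvP => x; rewrite memv_ker memv0.
  rewrite add_lfunE -aEf -linearD => /eqP; rewrite -(linear0 f) => /(can_inj fK) /eqP.
  rewrite addrC addr_eq0 => /eqP ax; apply/eqP.
  apply: (nilpotent_eigen0 nil _ (two_neq0 char_k)).
  by rewrite add_lfunE opp_lfunE id_lfunE ax opprK scaler_nat mulr2n.
have b_perp0 p x y : x \in psi p -> y \in psi (P222_perp p) -> b x y = 0.
  by move=> xp yp; rewrite bE (f_perp p) // (f_perp' p) // addr0.
have b_perp := perp_of_dim b0 b_perp0 dim_perp.
have [g [g_rep g0 g_skew]] := skew_element char_k psi_indec b_sym b0 b_perp even_V.
apply: (symp_of (b \o g)%VF) => [|x y|p x y xp yp].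
- apply/eqP; rewrite -subv0 -g0; apply/subvP => x; rewrite !memv_ker comp_lfunE.
  by rewrite -memv_ker b0 memv0.
- by rewrite !comp_lfunE g_skew b_sym.
by rewrite comp_lfunE (b_perp0 p) // g_rep.
Qed.
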